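(* Let $d\ge 1$, let $\varepsilon\in(0,1/2)$, and let $\mu_0,\mu_1,\dots,\mu_d$ be absolutely continuous probability measures on $\mathbb R^d$ that are $\varepsilon$-not-permuted. Then there exists a halfspace $H\subset\mathbb R^d$ such that \[ \mu_0(H)=\mu_1(H)=\dots=\mu_d(H)\in[\varepsilon,1/2]. \]
   Context: A halfspace is a set $\{x\in\mathbb R^d:\langle u,x\rangle\ge c\}$ with $u\neq 0$ (since the measures are absolutely continuous, whether it is open or closed is irrelevant). Definition: for $\varepsilon\in(0,1/2)$, absolutely continuous probability measures $\mu_0,\dots,\mu_d$ on $\mathbb R^d$ are called $\varepsilon$-not-permuted if for every halfspace $H$ such that $\mu_i(H)<\varepsilon$ for all $i=0,1,\dots,d$, there exist indices $i<j$ with $\mu_i(H)\ge\mu_j(H)$. *)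

(* Defs.v *)
From Stdlib Require Import Reals.
From mathcomp Require Import all_boot.
Set Implicit Arguments.
Unset Strict Implicit.
Unset Printing Implicit Defensive.

Local Open Scope R_scope.

Definition pt (d : nat) := 'I_d -> R.

Definition inner (d : nat) (u x : pt d) : R :=
  \big[Rplus/0]_(i < d) (u i * x i).

(* open sets of R^d (product / sup-norm topology = Euclidean topology) *)
Definition is_open (d : nat) (A : pt d -> Prop) : Prop :=
  forall x, A x -> exists delta, 0 < delta /\
    forall y : pt d, (forall i, Rabs (y i - x i) < delta) -> A y.

Inductive borel (d : nat) : (pt d -> Prop) -> Prop :=
  | borel_open : forall A, is_open A -> borel A
  | borel_compl : forall A, borel A -> borel (fun x => ~ A x)
  | borel_cunion : forall A : nat -> pt d -> Prop,
      (forall n, borel (A n)) -> borel (fun x => exists n, A n x)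
  | borel_ext : forall A B, borel A -> (forall x, A x <-> B x) -> borel B.

Definition box_vol (d : nat) (a b : pt d) : R :=
  \big[Rmult/1]_(i < d) (b i - a i).

Definition lebesgue_null (d : nat) (A : pt d -> Prop) : Prop :=
  forall eps, 0 < eps -> exists a b : nat -> pt d,
    (forall n i, a n i <= b n i) /\
    (forall x, A x -> exists n, forall i, a n i <= x i <= b n i) /\
    (forall N, sum_f_R0 (fun n => box_vol (a n) (b n)) N <= eps).

(* probability measure on the Borel sets of R^d (values on non-Borel sets
   are irrelevant) *)
Definition prob_measure (d : nat) (mu : (pt d -> Prop) -> R) : Prop :=
  (forall A, borel A -> 0 <= mu A) /\
  mu (fun _ => True) = 1 /\
  (forall A : nat -> pt d -> Prop,
      (forall n, borel (A n)) ->
      (forall m n x, m <> n -> A m x -> A n x -> False) ->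
      infinite_sum (fun n => mu (A n)) (mu (fun x => exists n, A n x))).

Definition abs_continuous (d : nat) (mu : (pt d -> Prop) -> R) : Prop :=
  forall A, borel A -> lebesgue_null A -> mu A = 0.

Definition nonzero_vec (d : nat) (u : pt d) : Prop := exists i, u i <> 0.

Definition halfspace (d : nat) (u : pt d) (c : R) : pt d -> Prop :=
  fun x => inner u x >= c.

Definition not_permuted (d : nat) (eps : R)
    (mu : nat -> (pt d -> Prop) -> R) : Prop :=
  forall (u : pt d) (c : R), nonzero_vec u ->
    (forall i, (i <= d)%N -> mu i (halfspace u c) < eps) ->
    exists i j, (i < j)%N /\ (j <= d)%N /\
      mu i (halfspace u c) >= mu j (halfspace u c).

(* Main.v *)
Require Import Defs.
From Stdlib Require Import Reals Lra Lia.
From mathcomp Require Import all_boot.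
From mathcomp Require Import boolp Rstruct.
Set Implicit Arguments.
Unset Strict Implicit.
Unset Printing Implicit Defensive.
Local Open Scope R_scope.

(** Halfspaces of [R^d] are parametrized by the nonzero [p = (c, u)] in
    [R^(d+1)], and [f_i p], the [i]-th measure of the halfspace, is continuous
    because hyperplanes are null; moreover [f_i (- p) = 1 - f_i p].  Let
    [phi p >= 0] be continuous and positive exactly where all [f_i p < eps].
    The map [p |-> (f_(j+1) p - f_j p - (phi p - phi (- p)))_(j < d)] is odd,
    so it has a zero by Borsuk-Ulam.  If [phi p > 0] then [phi (- p) = 0] and
    the [f_i p < eps] are strictly increasing in [i], which is excluded;
    likewise for [- p].  Hence both terms vanish, all [f_i p] agree, and their
    common value is at least [eps] at both [p] and [- p]; one of the two values
    is at most 1/2.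

    Borsuk-Ulam is proved with chains modulo 2.  The hemispheres [c_k] of the
    cross-polytope satisfy [boundary c_k = c_(k-1) + A c_(k-1)], where [A] is the
    antipodal map, and iterated barycentric subdivision preserves this.  If [a+]
    and [a-] count the simplices whose labels, sorted by absolute value,
    alternate in sign starting with + and -, then [a+ (boundary s) = a+ s + a- s].
    So [a+ + a-] has the same value on all [c_k], namely 1, whereas it vanishes
    on [c_n] when there are [n] labels up to sign and no simplex carries
    opposite labels (Tucker's lemma). *)

(** * Chains modulo 2 *)

(* A chain is a list of simplices and a simplex a list of vertices; two chains
   are equal modulo 2 when [parity f] agrees on them for all cochains [f].  The
   empty list is the simplex of dimension -1. *)
Definition parity (T : Type) (f : T -> bool) (c : seq T) : bool :=
  \big[addb/false]_(s <- c) f s.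

Lemma parity_cat (T : Type) (f : T -> bool) (c1 c2 : seq T) :
  parity f (c1 ++ c2) = parity f c1 (+) parity f c2.
Proof. by rewrite /parity big_cat. Qed.

Lemma parity_cons (T : Type) (f : T -> bool) (s : T) (c : seq T) :
  parity f (s :: c) = f s (+) parity f c.
Proof. by rewrite /parity big_cons. Qed.

Lemma parity_nil (T : Type) (f : T -> bool) : parity f [::] = false.
Proof. by rewrite /parity big_nil. Qed.

Lemma parity_map (T U : Type) (g : T -> U) (f : U -> bool) (c : seq T) :
  parity f [seq g s | s <- c] = parity (fun s => f (g s)) c.
Proof. by rewrite /parity big_map. Qed.

Lemma parity_flatmap (T U : Type) (g : T -> seq U) (f : U -> bool) (c : seq T) :
  parity f (flatten [seq g s | s <- c]) = parity (fun s => parity f (g s)) c.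
Proof. by rewrite /parity big_flatten big_map. Qed.

Lemma eq_parity (T : Type) (f g : T -> bool) (c : seq T) :
  f =1 g -> parity f c = parity g c.
Proof. by move=> fg; apply: eq_bigr => s _; exact: fg. Qed.

Lemma eq_parity_in (T : eqType) (f g : T -> bool) (c : seq T) :
  {in c, f =1 g} -> parity f c = parity g c.
Proof. by move=> fg; apply: eq_big_seq. Qed.

Lemma parity_addb (T : Type) (f g : T -> bool) (c : seq T) :
  parity (fun s => f s (+) g s) c = parity f c (+) parity g c.
Proof. by rewrite /parity big_split. Qed.

(** A vertex has the empty simplex as its only facet, so the boundary is the augmented one; the
    counts in Tucker's lemma start from there. Modulo 2 no signs occur. *)
Fixpoint facets (V : Type) (s : seq V) : seq (seq V) :=
  if s is x :: s' then s' :: [seq x :: t | t <- facets s'] else [::].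

Definition boundary (V : Type) (c : seq (seq V)) : seq (seq V) :=
  flatten [seq facets s | s <- c].

Lemma size_facets (V : eqType) (s t : seq V) : t \in facets s -> size s = (size t).+1.
Proof.
elim: s t => // x s IHs t; rewrite inE => /predU1P[-> //|/mapP[t' /IHs e ->]].
by rewrite /= e.
Qed.

Lemma mem_facets (V : eqType) (s t : seq V) : t \in facets s -> {subset t <= s}.
Proof.
elim: s t => // x s IHs t; rewrite inE => /predU1P[-> y|/mapP[t' /IHs e ->] y].
  by rewrite inE orbC => ->.
by rewrite !inE => /predU1P[->|/e ->]; rewrite ?eqxx ?orbT.
Qed.

Lemma parity_boundary (V : Type) (f : seq V -> bool) (c : seq (seq V)) :
  parity f (boundary c) = parity (fun s => parity f (facets s)) c.
Proof. exact: parity_flatmap. Qed.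

Lemma parity_facets_cons (V : Type) (f : seq V -> bool) (x : V) (s : seq V) :
  parity f (facets (x :: s)) = f s (+) parity (fun t => f (x :: t)) (facets s).
Proof. by rewrite /= parity_cons parity_map. Qed.

(** The cone formula [boundary (x * c) = c + x * boundary c], tested against a cochain [f]. *)
Lemma parity_boundary_cone (V : Type) (f : seq V -> bool) (x : V) (c : seq (seq V)) :
  parity f (boundary [seq x :: s | s <- c])
  = parity f c (+) parity (fun t => f (x :: t)) (boundary c).
Proof.
rewrite !parity_boundary parity_map -parity_addb.
by apply: eq_parity => s; rewrite parity_facets_cons.
Qed.

(** The square of the boundary vanishes: the cone formula yields a second copy of [facets s], which
    cancels the first, and a cone over a chain that is zero by induction. *)
Lemma parity_facets_facets (V : Type) (f : seq V -> bool) (s : seq V) :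
  parity f (boundary (facets s)) = false.
Proof.
elim: s f => [|x s IHs] f; first by rewrite parity_nil.
have -> : boundary (facets (x :: s))
    = facets s ++ boundary [seq x :: t | t <- facets s] by [].
by rewrite parity_cat parity_boundary_cone IHs addbF addbb.
Qed.

(* The recursion is on the number [n] of vertices of [s]. *)
Fixpoint subdiv (V : Type) (bary : seq V -> V) (n : nat) (s : seq V) :
    seq (seq V) :=
  if n is n'.+1 then
    [seq bary s :: t | t <- flatten [seq subdiv bary n' t | t <- facets s]]
  else [:: [::]].

Definition subdivc (V : Type) (bary : seq V -> V) (n : nat) (c : seq (seq V)) :=
  flatten [seq subdiv bary n s | s <- c].

Lemma parity_subdivc (V : Type) (bary : seq V -> V) (n : nat) f (c : seq (seq V)) :
  parity f (subdivc bary n c) = parity (fun s => parity f (subdiv bary n s)) c.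
Proof. exact: parity_flatmap. Qed.

(* Modulo 2, [boundary (b * C) = C + b * boundary C]; for [C = subdivc (facets s)]
   the second term vanishes by induction because [boundary (facets s) = 0]. *)
Lemma parity_facets_subdiv (V : eqType) (bary : seq V -> V) (n : nat) (s : seq V) f :
  size s = n.+1 ->
  parity f (boundary (subdiv bary n.+1 s)) = parity f (subdivc bary n (facets s)).
Proof.
elim: n s f => [|n IHn] s f ss.
  by case: s ss => [//|x [|//]] _; rewrite /= /boundary /= /parity big_seq1.
rewrite [subdiv _ _ _]/= parity_boundary_cone -/(subdivc bary n.+1 (facets s)).
set g := (fun t => f (_ :: t)).
suff -> : parity g (boundary (subdivc bary n.+1 (facets s))) = false by rewrite addbF.
rewrite parity_boundary parity_subdivc.
rewrite (@eq_parity_in _ _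
  (fun t => parity (fun s => parity g (subdiv bary n s)) (facets t))).
  by rewrite -parity_boundary parity_facets_facets.
move=> t /size_facets; rewrite ss => -[st].
by rewrite -parity_boundary IHn // parity_subdivc.
Qed.

Lemma size_subdiv (V : eqType) (bary : seq V -> V) (n : nat) (s t : seq V) :
  t \in subdiv bary n s -> size t = n.
Proof.
elim: n s t => [|n IHn] s t /=; first by rewrite inE => /eqP ->.
by case/mapP=> t' /flattenP[c /mapP[s' _ ->] /IHn /= <-] ->.
Qed.

Definition subdivi (V : Type) (bary : seq V -> V) (n m : nat) (c : seq (seq V)) :=
  iter m (subdivc bary n) c.

Lemma subdivc_homog (V : eqType) (bary : seq V -> V) (n : nat) (c : seq (seq V)) :
  {in subdivc bary n c, forall s, size s = n}.
Proof. by move=> t /flattenP[x /mapP[s _ ->] /size_subdiv]. Qed.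

Lemma subdivi_homog (V : eqType) (bary : seq V -> V) (n m : nat) (c : seq (seq V)) :
  {in c, forall s, size s = n} -> {in subdivi bary n m c, forall s, size s = n}.
Proof. by case: m => [//|m] _; exact: subdivc_homog. Qed.

Lemma parity_facets_subdivc (V : eqType) (bary : seq V -> V) (n : nat) (c : seq (seq V)) f :
  {in c, forall s, size s = n.+1} ->
  parity f (boundary (subdivc bary n.+1 c)) = parity f (subdivc bary n (boundary c)).
Proof.
move=> hc; rewrite parity_boundary !parity_subdivc parity_boundary.
apply: eq_parity_in => s /hc ss.
by rewrite -parity_boundary parity_facets_subdiv // parity_subdivc.
Qed.

(** Chains that are equal modulo 2 may differ as lists, so equality is carried through subdivision
    by pulling the cochain back. *)
Lemma parity_subdivi_ext (V : Type) (bary : seq V -> V) (n m : nat)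
    (c c' : seq (seq V)) f :
  (forall g, parity g c = parity g c') ->
  parity f (subdivi bary n m c) = parity f (subdivi bary n m c').
Proof.
by move=> h; elim: m f => [//|m IHm] f; rewrite /subdivi /= !parity_subdivc IHm.
Qed.

Lemma parity_facets_subdivi (V : eqType) (bary : seq V -> V) (n m : nat)
    (c : seq (seq V)) f :
  {in c, forall s, size s = n.+1} ->
  parity f (boundary (subdivi bary n.+1 m c)) = parity f (subdivi bary n m (boundary c)).
Proof.
move=> hc; elim: m f => [//|m IHm] f.
rewrite [subdivi _ n.+1 _ _]/= parity_facets_subdivc; last exact: subdivi_homog.
by rewrite [subdivi _ n _ _]/= !parity_subdivc IHm.
Qed.

Lemma subdivi_cat (V : Type) (bary : seq V -> V) (n m : nat) (c c' : seq (seq V)) :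
  subdivi bary n m (c ++ c') = subdivi bary n m c ++ subdivi bary n m c'.
Proof.
elim: m => [//|m IHm]; rewrite /subdivi /= -!/(subdivi _ _ _ _) IHm.
by rewrite /subdivc map_cat flatten_cat.
Qed.

(** * The antipodal map and the cross-polytope *)

Definition map_chain (V : Type) (neg : V -> V) (c : seq (seq V)) :=
  [seq map neg s | s <- c].

Lemma facets_map (V W : Type) (f : V -> W) (s : seq V) :
  facets (map f s) = [seq map f t | t <- facets s].
Proof. by elim: s => //= x s ->; rewrite -!map_comp. Qed.

Lemma subdiv_map (V : Type) (neg : V -> V) (bary : seq V -> V) (n : nat)
    (s : seq V) :
  (forall s, bary (map neg s) = neg (bary s)) ->
  subdiv bary n (map neg s) = map_chain neg (subdiv bary n s).
Proof.
move=> hb; elim: n s => [//|n IHn] s /=.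
rewrite hb facets_map /map_chain -!map_comp.
have -> : flatten [seq subdiv bary n (map neg t) | t <- facets s]
    = map_chain neg (flatten [seq subdiv bary n t | t <- facets s]).
  by rewrite /map_chain map_flatten -map_comp; congr flatten; apply: eq_map => t /=.
by rewrite /map_chain -!map_comp; apply: eq_map.
Qed.

Lemma subdivi_map (V : Type) (neg : V -> V) (bary : seq V -> V) (n m : nat)
    (c : seq (seq V)) :
  (forall s, bary (map neg s) = neg (bary s)) ->
  subdivi bary n m (map_chain neg c) = map_chain neg (subdivi bary n m c).
Proof.
move=> hb; elim: m => [//|m IHm].
rewrite /subdivi /= -!/(subdivi _ _ _ _) IHm /subdivc /map_chain.
rewrite -map_comp map_flatten -map_comp.
by congr flatten; apply: eq_map => s /=; rewrite subdiv_map.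
Qed.

(* The facets of the cross-polytope on [e 0, ..., e k.-1]; [hemisphere k] below
   is the half of the sphere on [e 0, ..., e k] that contains [e k]. *)
Fixpoint cross_polytope (V : Type) (neg : V -> V) (e : nat -> V) (k : nat) :
    seq (seq V) :=
  if k is k'.+1 then
    [seq e k' :: t | t <- cross_polytope neg e k']
    ++ [seq neg (e k') :: t | t <- cross_polytope neg e k']
  else [:: [::]].

Definition hemisphere (V : Type) (neg : V -> V) (e : nat -> V) (k : nat) :=
  [seq e k :: t | t <- cross_polytope neg e k].

Lemma cross_polytope_homog (V : eqType) (neg : V -> V) (e : nat -> V) (k : nat) :
  {in cross_polytope neg e k, forall s, size s = k}.
Proof.
elim: k => [|k IHk] s /=; first by rewrite inE => /eqP ->.
by rewrite mem_cat => /orP[] /mapP[t /IHk <- ->].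
Qed.

Lemma hemisphere_homog (V : eqType) (neg : V -> V) (e : nat -> V) (k : nat) :
  {in hemisphere neg e k, forall s, size s = k.+1}.
Proof. by move=> s /mapP[t /cross_polytope_homog <- ->]. Qed.

(** The base is a cycle by induction, so each of the two cones has the base as its boundary, and the
    two copies cancel. *)
Lemma parity_facets_cross_polytope (V : Type) (neg : V -> V) (e : nat -> V) (k : nat) f :
  parity f (boundary (cross_polytope neg e k)) = false.
Proof.
elim: k f => [|k IHk] f; first by rewrite /boundary /= parity_nil.
rewrite parity_boundary parity_cat -!parity_boundary !parity_boundary_cone.
by rewrite !IHk !addbF addbb.
Qed.

Lemma parity_facets_hemisphere (V : Type) (neg : V -> V) (e : nat -> V) (k : nat) f :
  parity f (boundary (hemisphere neg e k)) = parity f (cross_polytope neg e k).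
Proof. by rewrite parity_boundary_cone parity_facets_cross_polytope addbF. Qed.

(** The antipodal map exchanges the two cones, which changes the list but not the chain modulo 2. *)
Lemma parity_map_cross_polytope (V : Type) (neg : V -> V) (e : nat -> V) (k : nat) f :
  (forall k, neg (neg (e k)) = e k) ->
  parity f (map_chain neg (cross_polytope neg e k)) = parity f (cross_polytope neg e k).
Proof.
move=> negK; elim: k f => [//|k IHk] f.
rewrite /= /map_chain map_cat !parity_cat -!map_comp addbC; congr addb.
  rewrite !parity_map /= negK -(IHk (fun t => f (e k :: t))) /map_chain parity_map.
  by apply: eq_parity.
rewrite !parity_map /= -(IHk (fun t => f (neg (e k) :: t))) /map_chain parity_map.
by apply: eq_parity.
Qed.

(** The second cone is the antipode of the first because their common base is antipodally invariant
    modulo 2. *)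
Lemma parity_cross_polytopeS (V : Type) (neg : V -> V) (e : nat -> V) (k : nat) f :
  (forall k, neg (neg (e k)) = e k) ->
  parity f (cross_polytope neg e k.+1)
  = parity f (hemisphere neg e k ++ map_chain neg (hemisphere neg e k)).
Proof.
move=> negK; rewrite /= !parity_cat; congr addb.
rewrite /map_chain !parity_map.
rewrite -(parity_map_cross_polytope k (fun t => f (neg (e k) :: t)) negK).
by rewrite /map_chain parity_map; apply: eq_parity.
Qed.

(** * Tucker's lemma *)

Fixpoint alternating (b : bool) (s : seq bool) : bool :=
  if s is x :: s' then (x == b) && alternating (~~ b) s' else true.

(** A nonempty alternating list has exactly one facet alternating from [b]: the last entry is
    deleted if the list starts with [b], the first one otherwise. A list that starts with [b] and
    has a single repetition has two such facets, any other list none. *)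
Lemma parity_facets_alternating (b : bool) (s : seq bool) :
  parity (alternating b) (facets s) = alternating b s (+) alternating (~~ b) s.
Proof.
elim: s b => [|x s IHs] b; first by rewrite parity_nil.
rewrite parity_facets_cons.
have -> : parity (fun t => alternating b (x :: t)) (facets s)
    = (x == b) && parity (alternating (~~ b)) (facets s).
  case: (boolP (x == b)) => xb /=; first by apply: eq_parity => t /=; rewrite xb.
  by rewrite /parity big1 // => t _; rewrite /= (negbTE xb).
by rewrite IHs /= negbK; case: x b => [] [] /=;
  case: (alternating true s); case: (alternating false s).
Qed.

(* The label [(i, true)] stands for [+ i] and [(i, false)] for [- i]. *)
Definition label_le : rel (nat * bool) :=
  fun a b => (a.1 < b.1)%N || (a.1 == b.1) && (a.2 ==> b.2).

Lemma label_le_total : total label_le.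
Proof.
move=> [i a] [j b]; rewrite /label_le /=; case: ltngtP => //= _.
by case: a b => [] [].
Qed.

Lemma label_le_trans : transitive label_le.
Proof.
move=> [i a] [j b] [k c]; rewrite /label_le /=.
case/orP=> [lji|/andP[/eqP-> ba]].
  case/orP=> [lik|/andP[/eqP<- _]]; last by rewrite lji.
  by rewrite (ltn_trans lji lik).
case/orP=> [->//|/andP[/eqP<- ac]]; rewrite eqxx /=.
by apply/orP; right; case: a b c ba ac => [] [] [].
Qed.

Lemma label_le_anti : antisymmetric label_le.
Proof.
move=> [i a] [j b]; rewrite /label_le /=; case: ltngtP => //= -> /andP[ab ba].
by congr (_, _); case: a b ab ba => [] [].
Qed.

Definition alternating_labels (b : bool) (l : seq (nat * bool)) : bool :=
  alternating b [seq a.2 | a <- sort label_le l].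

Lemma alternating_labels_perm (b : bool) (l l' : seq (nat * bool)) :
  perm_eq l l' -> alternating_labels b l = alternating_labels b l'.
Proof.
move=> /(perm_sortP label_le_total label_le_trans label_le_anti) e.
by rewrite /alternating_labels e.
Qed.

(** Deleting an entry and deleting the first occurrence of its value give the same list up to
    permutation. The right-hand side is a sum over the entries, so permuting [l] only reindexes
    it. *)
Lemma parity_facets_perm_inv (T : eqType) (f : seq T -> bool) (l : seq T) :
  (forall l1 l2, perm_eq l1 l2 -> f l1 = f l2) ->
  parity f (facets l) = parity (fun x => f (rem x l)) l.
Proof.
elim: l f => [|x l IHl] f hf; first by rewrite !parity_nil.
rewrite parity_facets_cons parity_cons /= eqxx; congr addb.
rewrite IHl; last by move=> l1 l2 h; apply: hf; rewrite perm_cons.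
apply: eq_parity_in => y yl; case: (x =P y) => [->|//].
by apply: hf; rewrite perm_sym; apply: perm_to_rem.
Qed.

Lemma parity_facets_perm (T : eqType) (f : seq T -> bool) (l l' : seq T) :
  (forall l1 l2, perm_eq l1 l2 -> f l1 = f l2) ->
  perm_eq l l' -> parity f (facets l) = parity f (facets l').
Proof.
move=> hf ll'; rewrite !parity_facets_perm_inv // /parity (perm_big _ ll') /=.
apply: eq_big_seq => x xl; apply: hf.
rewrite -(perm_cons x) -(permPl (perm_to_rem _)) ?(perm_mem ll') //.
by rewrite (permPl ll') perm_to_rem.
Qed.

Lemma mem_facets_sorted (T : eqType) (r : rel T) (s t : seq T) :
  transitive r -> sorted r s -> t \in facets s -> sorted r t.
Proof.
move=> tr; elim: s t => // x s IHs t /= px.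
have ss : sorted r s by apply: path_sorted px.
rewrite inE => /predU1P[->//|/mapP[t' ht ->]] /=.
rewrite (path_sortedE tr) (IHs _ ss ht) andbT.
apply/allP => y /(mem_facets ht) ys.
by move: px; rewrite (path_sortedE tr) => /andP[/allP/(_ _ ys)].
Qed.

(** After sorting [l], its facets are sorted as well, and the identity for lists of signs applies to
    them. *)
Lemma parity_facets_alternating_labels (b : bool) (l : seq (nat * bool)) :
  parity (alternating_labels b) (facets l)
  = alternating_labels b l (+) alternating_labels (~~ b) l.
Proof.
have pl : perm_eq l (sort label_le l) by rewrite perm_sym perm_sort.
rewrite (parity_facets_perm (@alternating_labels_perm b) pl) {2 3}/alternating_labels.
rewrite -parity_facets_alternating facets_map parity_map.
apply: eq_parity_in => t ht; rewrite /alternating_labels sorted_sort //.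
  exact: label_le_trans.
apply: mem_facets_sorted ht; first exact: label_le_trans.
exact/sort_sorted/label_le_total.
Qed.

Definition opp_label (a : nat * bool) : nat * bool := (a.1, ~~ a.2).

Definition complementary_free (l : seq (nat * bool)) : Prop :=
  {in l &, forall a b, a <> opp_label b}.

Lemma alternating_negb (b : bool) (s : seq bool) :
  alternating b (map negb s) = alternating (~~ b) s.
Proof. by elim: s b => //= x s IHs b; rewrite IHs; case: x b => [] []. Qed.

(** Without complementary pairs, labels of equal absolute value have equal sign, so reversing all
    signs preserves the sorted order. *)
Lemma alternating_labels_opp (b : bool) (l : seq (nat * bool)) :
  complementary_free l ->
  alternating_labels b (map opp_label l) = alternating_labels (~~ b) l.
Proof.
move=> hl; rewrite /alternating_labels -alternating_negb -map_comp.
suff -> : sort label_le (map opp_label l) = map opp_label (sort label_le l).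
  by rewrite -map_comp.
apply: (sorted_eq label_le_trans label_le_anti).
- exact/sort_sorted/label_le_total.
- have ml : all (mem l) (sort label_le l).
    by apply/allP => x; rewrite mem_sort.
  rewrite sorted_map -(eq_in_sorted (e := label_le) _ ml).
    exact/sort_sorted/label_le_total.
  move=> [i a] [j c] il jl; rewrite /label_le /=; case: ltngtP => //= e.
  have -> : a = c.
    move: (hl _ _ il jl) => /=; rewrite /opp_label /= e.
    by case: a c {il jl} => [] [] // h; case: h.
  by rewrite !implybb.
- by rewrite perm_sort perm_map // perm_sym perm_sort.
Qed.

(* Consecutive labels of an alternating sorted list differ in sign, hence, in
   the absence of complementary pairs, also in absolute value. *)
Lemma alternating_labels_big (b : bool) (n : nat) (l : seq (nat * bool)) :
  complementary_free l -> {in l, forall a, (a.1 < n)%N} -> (n < size l)%N ->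
  alternating_labels b l = false.
Proof.
move=> hl hn sl; apply/negP => ha.
suff u : uniq [seq a.1 | a <- sort label_le l].
  have : {subset [seq a.1 | a <- sort label_le l] <= iota 0 n}.
    by move=> _ /mapP[a + ->]; rewrite mem_sort mem_iota => /hn.
  by move/(uniq_leq_size u); rewrite size_map size_sort size_iota leqNgt sl.
suff h : forall s b, sorted label_le s -> complementary_free s ->
    alternating b [seq a.2 | a <- s] -> sorted ltn [seq a.1 | a <- s].
  apply: (sorted_uniq ltn_trans ltnn); apply: (h _ b) => //.
    exact/sort_sorted/label_le_total.
  by move=> x y; rewrite !mem_sort; apply: hl.
elim=> // x [//|y s] IHs b' /andP[xy ps] cf /= /and3P[xb yb al].
apply/andP; split; last first.
  apply: (IHs (~~ b') ps); last by rewrite /= yb al.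
  by move=> u v us vs; apply: cf; rewrite inE ?us ?vs orbT.
move: xy; rewrite /label_le; case/orP=> // /andP[/eqP e _].
case: (cf x y); rewrite ?inE ?eqxx ?orbT //.
rewrite /opp_label -e (eqP yb) negbK.
by case: x xb {cf e ps} => x1 x2 /= /eqP ->.
Qed.

(* The counts of positive and of negative alternating simplices of the k-th
   hemisphere add up to an odd number for all k, which is impossible for
   k = n because there are only n absolute values of labels. *)
Lemma tucker (V : eqType) (neg : V -> V) (bary : seq V -> V) (e : nat -> V)
    (n m : nat) (lab : V -> nat * bool) :
  (forall s, bary (map neg s) = neg (bary s)) ->
  (forall k, neg (neg (e k)) = e k) ->
  (forall x, ((lab x).1 < n)%N) ->
  (forall k s x, (k <= n)%N -> s \in subdivi bary k.+1 m (hemisphere neg e k) ->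
     x \in s -> lab (neg x) = opp_label (lab x)) ->
  (forall k s x y, (k <= n)%N -> s \in subdivi bary k.+1 m (hemisphere neg e k) ->
     x \in s -> y \in s -> lab x <> opp_label (lab y)) ->
  False.
Proof.
move=> hb negK hn hopp hcf.
pose f b (s : seq V) := alternating_labels b (map lab s).
pose C k := subdivi bary k.+1 m (hemisphere neg e k).
have cfC k s : (k <= n)%N -> s \in C k -> complementary_free (map lab s).
  by move=> kn sC _ _ /mapP[x xs ->] /mapP[y ys ->]; exact: (hcf k s).
(* The facet identity is summed over [C k], whose boundary is the subdivided cross-polytope of one
   dimension less. *)
have step k : parity (fun s => f true s (+) f false s) (C k)
    = parity (f true) (subdivi bary k m (cross_polytope neg e k)).
  rewrite -(parity_subdivi_ext bary k m (f true) (parity_facets_hemisphere neg e k)).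
  rewrite -parity_facets_subdivi; last exact: hemisphere_homog.
  rewrite parity_boundary; apply: eq_parity => s.
  by rewrite /f -(parity_facets_alternating_labels true) facets_map parity_map.
have odd k : (k <= n)%N -> parity (fun s => f true s (+) f false s) (C k) = true.
  elim: k => [_|k IHk kn]; rewrite step.
    (* Here only the empty simplex is left, and it counts as alternating. *)
    have -> : subdivi bary 0 m (cross_polytope neg e 0) = [:: [::]].
      by elim: (m) => //= m' IH; rewrite /subdivi /= -/(subdivi _ _ _ _) IH.
    by rewrite /parity big_seq1.
  rewrite (parity_subdivi_ext bary k.+1 m _ (fun g => parity_cross_polytopeS k g negK)).
  rewrite subdivi_cat subdivi_map // parity_cat -[RHS](IHk (ltnW kn)) parity_addb.
  congr addb.
  (* The antipodal map reverses labels, so the antipodal half contributes the simplices of [C k]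
     that alternate starting with minus. *)
  rewrite /map_chain parity_map; apply: eq_parity_in => s sC.
  rewrite /f -(alternating_labels_opp true (cfC _ _ (ltnW kn) sC)) -!map_comp.
  congr alternating_labels; apply/eq_in_map => x xs /=.
  by apply: (hopp k s) => //; apply: ltnW.
have := odd n (leqnn n); rewrite /parity big_seq big1 // => s sC.
have ss : size s = n.+1 by apply: subdivi_homog sC; exact: hemisphere_homog.
have a0 b : f b s = false.
  apply: (@alternating_labels_big b n); first exact: cfC sC.
    by move=> _ /mapP[x _ ->].
  by rewrite size_map ss.
by rewrite !a0.
Qed.

(** * The Borsuk-Ulam theorem *)

Lemma sumR_le (T : eqType) (s : seq T) (f g : T -> R) :
  {in s, forall x, f x <= g x} ->
  \big[Rplus/0]_(x <- s) f x <= \big[Rplus/0]_(x <- s) g x.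
Proof.
elim: s => [|x s IHs] h; first by rewrite !big_nil; lra.
rewrite !big_cons; apply: Rplus_le_compat; first by apply: h; rewrite inE eqxx.
by apply: IHs => y ys; apply: h; rewrite inE ys orbT.
Qed.

Lemma INR_size_cons (T : Type) (x : T) (s : seq T) :
  INR (size (x :: s)) = INR (size s) + 1.
Proof. exact: S_INR. Qed.

Lemma sumR_const (T : Type) (s : seq T) (a : R) :
  \big[Rplus/0]_(x <- s) a = INR (size s) * a.
Proof.
elim: s => [|x s IHs]; first by rewrite big_nil /=; lra.
by rewrite big_cons IHs INR_size_cons; lra.
Qed.

Lemma sumR_abs (T : Type) (s : seq T) (f : T -> R) :
  Rabs (\big[Rplus/0]_(x <- s) f x) <= \big[Rplus/0]_(x <- s) Rabs (f x).
Proof.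
elim: s => [|x s IHs]; first by rewrite !big_nil Rabs_R0; lra.
by rewrite !big_cons; apply: Rle_trans (Rabs_triang _ _) _; lra.
Qed.

Lemma sumR_scal (T : Type) (s : seq T) (f : T -> R) (a : R) :
  \big[Rplus/0]_(x <- s) (a * f x) = a * \big[Rplus/0]_(x <- s) f x.
Proof. by rewrite big_distrr. Qed.

Lemma sumR_opp (T : Type) (s : seq T) (f : T -> R) :
  \big[Rplus/0]_(x <- s) (- f x) = - \big[Rplus/0]_(x <- s) f x.
Proof.
by elim: s => [|x s IHs]; rewrite ?big_nil ?big_cons ?IHs; lra.
Qed.

(** * Barycentric subdivision in coordinates *)

Definition neg (n : nat) (x : 'I_n -> R) : 'I_n -> R := fun i => - x i.

Definition bary (n : nat) (s : seq ('I_n -> R)) : 'I_n -> R :=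
  fun i => \big[Rplus/0]_(x <- s) x i / INR (size s).

Lemma bary_neg (n : nat) (s : seq ('I_n -> R)) :
  bary (map (@neg n) s) = neg (bary s).
Proof.
apply: funext => i; rewrite /bary /neg big_map sumR_opp size_map.
by rewrite /Rdiv; lra.
Qed.

Lemma negK (n : nat) (x : 'I_n -> R) : neg (neg x) = x.
Proof. by apply: funext => i; rewrite /neg; lra. Qed.

Lemma INR_size_gt0 (T : Type) (s : seq T) : (0 < size s)%N -> 0 < INR (size s).
Proof. by move=> ss; apply: lt_0_INR; apply/ltP. Qed.

(** The form of convexity that passes a property from the vertices of a simplex to all vertices of
    its subdivisions. *)
Definition bary_closed (n : nat) (P : ('I_n -> R) -> Prop) : Prop :=
  forall s : seq ('I_n -> R),
    (0 < size s)%N -> {in s, forall x, P x} -> P (bary s).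

Lemma bary_closed_interval (n : nat) (a b : 'I_n -> R) :
  bary_closed (fun x => forall i, a i <= x i <= b i).
Proof.
move=> s ss h i; have s0 := INR_size_gt0 ss; rewrite /bary.
have h1 : INR (size s) * a i <= \big[Rplus/0]_(x <- s) x i.
  by rewrite -sumR_const; apply: sumR_le => x /h/(_ i) [].
have h2 : \big[Rplus/0]_(x <- s) x i <= INR (size s) * b i.
  by rewrite -sumR_const; apply: sumR_le => x /h/(_ i) [].
set S := \big[Rplus/0]_(x <- s) x i in h1 h2 *.
have e : S = S / INR (size s) * INR (size s) by field; lra.
by split; apply: (Rmult_le_reg_r _ _ _ s0); lra.
Qed.

Lemma bary_closed_ball (n : nat) (a : 'I_n -> R) (r : R) :
  bary_closed (fun x => forall i, Rabs (x i - a i) <= r).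
Proof.
move=> s ss h.
have hI : {in s, forall x : 'I_n -> R, forall i, a i - r <= x i <= a i + r}.
  by move=> x /h hx i; have := hx i; split_Rabs; lra.
move=> i; have := bary_closed_interval ss hI i; split_Rabs; lra.
Qed.

Lemma bary_closed_inner (n : nat) (u : 'I_n -> R) (c : R) :
  bary_closed (fun x => inner u x = c).
Proof.
move=> s ss h; have s0 := INR_size_gt0 ss; rewrite /inner /bary.
transitivity (\big[Rplus/0]_(x <- s) inner u x * / INR (size s)).
  rewrite /inner exchange_big big_distrl /=; apply: eq_bigr => i _.
  by rewrite sumR_scal /Rdiv; lra.
have -> : \big[Rplus/0]_(x <- s) inner u x = \big[Rplus/0]_(x <- s) c.
  by apply: eq_big_seq.
by rewrite sumR_const; field; lra.
Qed.

Lemma subdiv_closed (n : nat) (P : ('I_n -> R) -> Prop) (k : nat)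
    (s t : seq ('I_n -> R)) :
  bary_closed P -> size s = k -> {in s, forall x, P x} ->
  t \in subdiv (@bary n) k s -> {in t, forall x, P x}.
Proof.
move=> hP; elim: k s t => [|k IHk] s t ss hs /=.
  by rewrite inE => /eqP -> x.
case/mapP=> t' /flattenP[c /mapP[s' s's ->] t's'] -> x.
rewrite inE => /predU1P[->|]; first by apply: hP; rewrite ?ss.
apply: IHk t's' x; first by move: (size_facets s's); rewrite ss => -[].
by move=> y /(mem_facets s's); apply: hs.
Qed.

Lemma mem_sdcP (V : eqType) (b : seq V -> V) (n : nat) (c : seq (seq V))
    (t : seq V) :
  t \in subdivc b n c -> exists2 s, s \in c & t \in subdiv b n s.
Proof. by case/flattenP=> x /mapP[s sc ->] ts; exists s. Qed.

Lemma subdivi_closed (n : nat) (P : ('I_n -> R) -> Prop) (k m : nat)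
    (c : seq (seq ('I_n -> R))) :
  bary_closed P -> {in c, forall s, size s = k} ->
  {in c, forall s, {in s, forall x, P x}} ->
  {in subdivi (@bary n) k m c, forall s, {in s, forall x, P x}}.
Proof.
move=> hP hk hc; elim: m => [//|m IHm] t /mem_sdcP[s sc ts].
by apply: subdiv_closed ts => //; [apply: (subdivi_homog hk sc)|apply: IHm].
Qed.

Definition diam_le (n : nat) (D : R) (s : seq ('I_n -> R)) : Prop :=
  {in s &, forall x y, forall i, Rabs (x i - y i) <= D}.

Lemma sum_dist_vertex (n : nat) (s : seq ('I_n -> R)) (D : R) v i :
  0 <= D -> {in s, forall x, Rabs (x i - v i) <= D} -> v \in s ->
  \big[Rplus/0]_(x <- s) Rabs (x i - v i) <= (INR (size s) - 1) * D.
Proof.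
move=> D0 h vs; rewrite (perm_big _ (perm_to_rem vs)) big_cons /=.
have -> : Rabs (v i - v i) = 0 by rewrite Rminus_diag Rabs_R0.
have -> : (INR (size s) - 1) * D = \big[Rplus/0]_(x <- rem v s) D.
  rewrite sumR_const (perm_size (perm_to_rem vs)) INR_size_cons.
  lra.
rewrite Rplus_0_l; apply: sumR_le => x /mem_rem; exact: h.
Qed.

(** [bary s - v] is the average of the [x - v], and the term [x = v] vanishes. This gives the factor
    [1 - 1 / size s], which increases with the size. *)
Lemma dist_bary_vertex (n N : nat) (s : seq ('I_n -> R)) (D : R) v :
  0 <= D -> (size s <= N.+1)%N -> diam_le D s -> v \in s ->
  forall i, Rabs (v i - bary s i) <= INR N / INR N.+1 * D.
Proof.
move=> D0 sN hD vs i.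
have s0 : 0 < INR (size s) by apply: INR_size_gt0; case: (s) vs.
have N0 : 0 < INR N.+1 by apply: lt_0_INR; apply/ltP.
have sN' : INR (size s) <= INR N.+1 by apply: le_INR; apply/leP.
have hs : \big[Rplus/0]_(x <- s) Rabs (x i - v i) <= (INR (size s) - 1) * D.
  by apply: sum_dist_vertex => // x xs; exact: hD.
have e : bary s i - v i = \big[Rplus/0]_(x <- s) (x i - v i) / INR (size s).
  rewrite /bary big_split /= sumR_const /Rdiv; field; lra.
rewrite Rabs_minus_sym e Rabs_mult Rabs_inv (Rabs_pos_eq (INR _)); last lra.
apply: (Rle_trans _ ((INR (size s) - 1) * D / INR (size s))).
  apply: Rmult_le_compat_r; first by apply/Rlt_le/Rinv_0_lt_compat.
  exact: Rle_trans (sumR_abs _ _) hs.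
have -> : (INR (size s) - 1) * D / INR (size s) = (1 - / INR (size s)) * D.
  by field; lra.
have -> : INR N / INR N.+1 = 1 - / INR N.+1.
  rewrite S_INR; field; rewrite -S_INR; lra.
apply: Rmult_le_compat_r => //.
have := Rinv_le_contravar _ _ s0 sN'; lra.
Qed.

(** Two vertices of [t] either both come from a subdivided facet, or one is the barycenter of [s];
    the ball around it that contains the vertices of a facet also contains those of its subdivision.
    One [N] serves all dimensions [k <= N.+1]. *)
Lemma subdiv_diam (n N k : nat) (s t : seq ('I_n -> R)) (D : R) :
  0 <= D -> (k <= N.+1)%N -> size s = k -> diam_le D s ->
  t \in subdiv (@bary n) k s -> diam_le (INR N / INR N.+1 * D) t.
Proof.
move=> D0; elim: k s t => [|k IHk] s t kN ss hD /=.
  by rewrite inE => /eqP -> x.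
case/mapP=> t' /flattenP[c /mapP[s' s's ->] t's'] ->.
have ss' : size s' = k by move: (size_facets s's); rewrite ss => -[].
have ball : {in t', forall x i, Rabs (x i - bary s i) <= INR N / INR N.+1 * D}.
  apply: subdiv_closed t's' => //; first exact: bary_closed_ball.
  by move=> x /(mem_facets s's) xs; apply: dist_bary_vertex; rewrite ?ss.
have q0 : 0 <= INR N / INR N.+1 * D.
  apply: Rmult_le_pos => //; apply: Rmult_le_pos; first exact: pos_INR.
  by apply/Rlt_le/Rinv_0_lt_compat/lt_0_INR/ltP.
move=> x y; rewrite !inE => /predU1P[->|xt] /predU1P[->|yt] i.
- by rewrite Rminus_diag Rabs_R0.
- by rewrite Rabs_minus_sym; apply: ball.
- exact: ball.
- apply: (IHk s' t') => //; first exact: ltnW.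
  by move=> u v /(mem_facets s's) us /(mem_facets s's) vs; apply: hD.
Qed.

Lemma subdivi_diam (n N k m : nat) (c : seq (seq ('I_n -> R))) (D : R) :
  0 <= D -> (k <= N.+1)%N -> {in c, forall s, size s = k} ->
  {in c, forall s, diam_le D s} ->
  {in subdivi (@bary n) k m c, forall s, diam_le ((INR N / INR N.+1) ^ m * D) s}.
Proof.
move=> D0 kN hk hD; have q0 : 0 <= INR N / INR N.+1.
  apply: Rmult_le_pos; first exact: pos_INR.
  by apply/Rlt_le/Rinv_0_lt_compat/lt_0_INR/ltP.
elim: m => [|m IHm] t.
  by move=> /hD ht x y xt yt i; rewrite /= Rmult_1_l; apply: ht.
case/mem_sdcP=> s sc ts; rewrite /= Rmult_assoc.
apply: (subdiv_diam _ kN) ts; last exact: IHm.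
  by apply: Rmult_le_pos => //; apply: pow_le.
exact: (subdivi_homog hk sc).
Qed.

Definition basis (n : nat) (k : nat) : 'I_n -> R :=
  fun i => if (i : nat) == k then 1 else 0.
Arguments basis : clear implicits.

Lemma inner_basis (n : nat) (u : 'I_n -> R) (i : 'I_n) :
  inner u (basis n i) = u i.
Proof.
rewrite /inner (bigD1 i) //= big1 => [|j ji]; rewrite /basis ?eqxx; first lra.
by rewrite (inj_eq val_inj) (negbTE ji); lra.
Qed.

Lemma inner_negr (n : nat) (u x : 'I_n -> R) : inner u (neg x) = - inner u x.
Proof. by rewrite /inner -sumR_opp; apply: eq_bigr => i _; rewrite /neg; lra. Qed.

(** The vector [u] collects the signs of the vertices of the face. Coordinates from [k] on vanish on
    the face, so the next sign can be put into [u] without changing [inner u] on the old vertices.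
    The hyperplane keeps all subdivisions of the face away from the origin. *)
Lemma cross_polytope_face (n k : nat) (s : seq ('I_n -> R)) :
  (k <= n)%N -> s \in cross_polytope (@neg n) (basis n) k ->
  {in s, forall (x : 'I_n -> R) (i : 'I_n),
     -1 <= x i <= 1 /\ ((k <= i)%N -> x i = 0)} /\
  exists2 u : 'I_n -> R, forall i, Rabs (u i) <= 1 &
    {in s, forall x, inner u x = 1}.
Proof.
elim: k s => [|k IHk] s kn.
  rewrite inE => /eqP ->; split=> //; exists (fun _ => 0) => // i.
  by rewrite Rabs_R0; lra.
suff H (b : bool) t : t \in cross_polytope (@neg n) (basis n) k ->
    let v := if b then basis n k else neg (basis n k) in
    {in v :: t, forall (x : 'I_n -> R) (i : 'I_n),
       -1 <= x i <= 1 /\ ((k < i)%N -> x i = 0)} /\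
    exists2 u : 'I_n -> R, forall i, Rabs (u i) <= 1 &
      {in v :: t, forall x, inner u x = 1}.
  rewrite mem_cat => /orP[] /mapP[t /H ht ->].
    exact: (ht true).
  exact: (ht false).
move=> /(IHk _ (ltnW kn)) [hx [u hu hin]] v; split.
  move=> x; rewrite inE => /predU1P[-> i|xt i].
    rewrite /v /neg /basis; case: b {v}; case: (i =P k :> nat) => [->|_];
      rewrite ?ltnn; by split=> //= *; lra.
  by have [h1 h2] := hx x xt i; split=> // /ltnW; exact: h2.
pose ik := Ordinal kn.
exists (fun i => if i == ik then if b then 1 else -1 else u i).
  move=> i; case: eqP => // _; case: (b); split_Rabs; lra.
move=> x; rewrite inE => /predU1P[->|xt].
  have eb : inner (fun i => if i == ik then if b then 1 else -1 else u i)
      (basis n k) = if b then 1 else -1.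
    by rewrite (inner_basis _ ik) eqxx.
  by rewrite /v; case: b {v} eb => eb; rewrite ?inner_negr eb; lra.
rewrite -(hin x xt); apply: eq_bigr => i _; case: eqP => // ->.
by have [_ ->] := hx x xt ik; [lra|].
Qed.

Lemma hemisphere_face (n k : nat) (s : seq ('I_n -> R)) :
  (k < n)%N -> s \in hemisphere (@neg n) (basis n) k ->
  {in s, forall (x : 'I_n -> R) (i : 'I_n), -1 <= x i <= 1} /\
  exists2 u : 'I_n -> R, forall i, Rabs (u i) <= 1 &
    {in s, forall x, inner u x = 1}.
Proof.
move=> kn hs; have : s \in cross_polytope (@neg n) (basis n) k.+1.
  by rewrite mem_cat; apply/orP; left.
by case/cross_polytope_face=> // hx hu; split=> // x xs i; have [] := hx x xs i.
Qed.

(** * Convergence and compactness of sequences *)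

Lemma Un_cv_sub (u : nat -> R) (l : R) (phi : nat -> nat) :
  (forall m, (m <= phi m)%N) -> Un_cv u l -> Un_cv (fun m => u (phi m)) l.
Proof.
move=> hphi hu e e0; have [N hN] := hu e e0; exists N => m /leP mN.
by apply: hN; apply/leP; apply: leq_trans mN (hphi m).
Qed.

Lemma Un_cv_squeeze0 (u w : nat -> R) (l : R) :
  (forall m, Rabs (u m - l) <= w m) -> Un_cv w 0 -> Un_cv u l.
Proof.
move=> h hw e e0; have [N hN] := hw e e0; exists N => m mN.
apply: Rle_lt_trans (h m) _; have := hN m mN; rewrite /R_dist; split_Rabs; lra.
Qed.

Lemma Un_cv_sum (T : Type) (s : seq T) (f : nat -> T -> R) (l : T -> R) :
  (forall i, Un_cv (fun m => f m i) (l i)) ->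
  Un_cv (fun m => \big[Rplus/0]_(i <- s) f m i) (\big[Rplus/0]_(i <- s) l i).
Proof.
move=> h; elim: s => [|x s IHs].
  rewrite big_nil => e e0; exists 0%N => m _.
  by rewrite big_nil /R_dist Rminus_diag Rabs_R0.
rewrite big_cons (_ : (fun m => _)
  = (fun m => f m x + \big[Rplus/0]_(i <- s) f m i)).
  exact: CV_plus.
by apply: funext => m; rewrite big_cons.
Qed.

Lemma Un_cv_const (a : R) : Un_cv (fun _ => a) a.
Proof. by move=> e e0; exists 0%N => m _; rewrite /R_dist Rminus_diag Rabs_R0. Qed.

Lemma INR_unbounded (x : R) : exists N, x < INR N.+1.
Proof.
exists (Z.to_nat (up x)); have [h _] := archimed x; rewrite S_INR.
have : IZR (up x) <= INR (Z.to_nat (up x)).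
  by rewrite INR_IZR_INZ; apply: IZR_le; lia.
lra.
Qed.

Lemma Un_cv_invS : Un_cv (fun m => / INR m.+1) 0.
Proof.
apply: cv_infty_cv_0 => M; have [N hN] := INR_unbounded M; exists N => m mN.
by apply: Rlt_le_trans hN _; apply: le_INR; lia.
Qed.

(** A cluster point [l] provides [phi m >= m] with [u (phi m)] within [1 / (m + 1)] of [l]. The
    condition [m <= phi m] is what passing to limits takes. *)
Lemma bolzano_weierstrass_seq (u : nat -> R) (a b : R) :
  (forall m, a <= u m <= b) ->
  exists (phi : nat -> nat) (l : R), (forall m, (m <= phi m)%N) /\
    Un_cv (fun m => u (phi m)) l.
Proof.
move=> h; have [l hl] := Bolzano_Weierstrass _ _ (compact_P3 a b) h.
have ex m : exists p, (m <= p)%N /\ Rabs (u p - l) < / INR m.+1.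
  have m0 : 0 < / INR m.+1 by apply/Rinv_0_lt_compat/lt_0_INR/ltP.
  have [|p [/leP mp hp]] := hl (disc l (mkposreal _ m0)) m; last by exists p.
  by exists (mkposreal _ m0).
have [phi hphi] := choice ex; exists phi, l; split.
  by move=> m; case: (hphi m).
apply: (@Un_cv_squeeze0 _ (fun m => / INR m.+1)).
  by move=> m; apply/Rlt_le; case: (hphi m).
exact: Un_cv_invS.
Qed.

Lemma bolzano_weierstrass_vec (n : nat) (x : nat -> 'I_n -> R) (a b : R) :
  (forall m i, a <= x m i <= b) ->
  exists (phi : nat -> nat) (l : 'I_n -> R), (forall m, (m <= phi m)%N) /\
    forall i, Un_cv (fun m => x (phi m) i) (l i).
Proof.
move=> h.
suff H (s : seq 'I_n) : exists (phi : nat -> nat) (l : 'I_n -> R),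
    (forall m, (m <= phi m)%N) /\
    forall i, i \in s -> Un_cv (fun m => x (phi m) i) (l i).
  have [phi [l [hphi hl]]] := H (enum 'I_n).
  by exists phi, l; split=> // i; apply: hl; rewrite mem_enum.
elim: s => [|j s [phi [l [hphi hl]]]].
  by exists id, (fun _ => 0); split.
have [psi [lj [hpsi hlj]]] := bolzano_weierstrass_seq (fun m => h (phi m) j).
exists (fun m => phi (psi m)), (fun i => if i == j then lj else l i); split.
  by move=> m; apply: leq_trans (hpsi m) (hphi _).
move=> i; rewrite inE; case: eqP => [-> //|_ /= /hl hi].
exact: (@Un_cv_sub (fun m => x (phi m) i)).
Qed.

(** * From Tucker's lemma to Borsuk-Ulam *)

Lemma exists_argmax (n : nat) (g : 'I_n.+1 -> R) :
  exists j, forall i, g i <= g j.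
Proof.
suff [j hj] : exists j, forall i, i \in enum 'I_n.+1 -> g i <= g j.
  by exists j => i; apply: hj; rewrite mem_enum.
elim: (enum _) => [|k s [j hj]]; first by exists ord0.
case: (Rle_lt_dec (g k) (g j)) => kj; [exists j|exists k] => i;
  rewrite inE => /predU1P[->|/hj]; lra.
Qed.

Lemma Un_cv_geom (q a : R) : 0 <= q < 1 -> Un_cv (fun m => q ^ m * a) 0.
Proof.
move=> hq; rewrite -(Rmult_0_l a); apply: CV_mult; last exact: Un_cv_const.
move=> e e0; have [|N hN] := @pow_lt_1_zero q _ e e0.
  by rewrite Rabs_pos_eq; lra.
by exists N => m mN; rewrite /R_dist Rminus_0_r; apply: hN.
Qed.

(** A vertex is labelled by the index of the largest coordinate of [G x] in absolute value, with its
    sign. Tucker's lemma gives two vertices of one simplex with opposite labels: their coordinates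
    at the common index [j] have opposite signs, which bounds [G x j] by the difference. *)
Lemma complementary_pairs (n : nat) (G : ('I_n.+2 -> R) -> 'I_n.+1 -> R) :
  (forall p, nonzero_vec p -> G (neg p) = neg (G p)) ->
  (forall p, nonzero_vec p -> nonzero_vec (G p)) ->
  forall m, exists x y : 'I_n.+2 -> R,
    (forall i, -1 <= x i <= 1) /\
    (forall i, Rabs (x i - y i) <= (INR n.+1 / INR n.+2) ^ m * 2) /\
    1 <= \big[Rplus/0]_(i < n.+2) Rabs (x i) /\
    exists j, (forall i, Rabs (G x i) <= Rabs (G x j)) /\
      Rabs (G x j) <= Rabs (G x j - G y j).
Proof.
move=> Godd Gnz m.
have [amax hmax] := choice (@exists_argmax n).
pose jx x := amax (fun i => Rabs (G x i)).
pose lab x : nat * bool :=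
  (nat_of_ord (jx x), if Rlt_dec 0 (G x (jx x)) then true else false).
(* The faces lie in the cube of side 2, whose sup-norm diameter is 2. *)
have hdim k : (k <= n.+1)%N ->
    {in subdivi (@bary n.+2) k.+1 m (hemisphere (@neg n.+2) (basis n.+2) k),
      forall s, diam_le ((INR n.+1 / INR n.+2) ^ m * 2) s}.
  move=> kn; apply: subdivi_diam => //; first lra; first exact: hemisphere_homog.
  move=> s /hemisphere_face -/(_ kn) [h _] x y xs ys i.
  by have := h x xs i; have := h y ys i; split_Rabs; lra.
have hbox k : (k <= n.+1)%N ->
    {in subdivi (@bary n.+2) k.+1 m (hemisphere (@neg n.+2) (basis n.+2) k),
      forall s, {in s, forall x : 'I_n.+2 -> R, forall i, -1 <= x i <= 1}}.
  move=> kn; apply: subdivi_closed.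
  - exact: (bary_closed_interval (a := fun _ => -1) (b := fun _ => 1)).
  - exact: hemisphere_homog.
  - by move=> s /hemisphere_face -/(_ kn) [h _] x xs i; apply: h.
have hnorm k : (k <= n.+1)%N ->
    {in subdivi (@bary n.+2) k.+1 m (hemisphere (@neg n.+2) (basis n.+2) k),
      forall s, {in s, forall x : 'I_n.+2 -> R,
        1 <= \big[Rplus/0]_(i < n.+2) Rabs (x i)}}.
  move=> kn s ss.
  have [u hu hin] : exists2 u : 'I_n.+2 -> R, forall i, Rabs (u i) <= 1 &
      {in s, forall x, inner u x = 1}.
    (* Each small simplex comes from a single face, on whose hyperplane it lies. *)
    have : exists2 s0, s0 \in hemisphere (@neg n.+2) (basis n.+2) k &
        s \in subdivi (@bary n.+2) k.+1 m [:: s0].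
      elim: m s ss {hdim hbox} => [|m' IHm] s ss.
        by exists s => //; rewrite inE.
      have [t /IHm[s0 hs0 ts0] st] := mem_sdcP ss.
      exists s0 => //; apply/flattenP; exists (subdiv (@bary n.+2) k.+1 t) => //.
      exact: map_f.
    case=> s0 hs0 ss0; have [_ [u hu hin]] := @hemisphere_face n.+2 k _ kn hs0.
    exists u => //; apply: subdivi_closed ss0.
    - exact: bary_closed_inner.
    - by move=> t; rewrite inE => /eqP ->; apply: hemisphere_homog hs0.
    - by move=> t; rewrite inE => /eqP ->.
  move=> x xs; rewrite -(hin x xs); apply: Rle_trans (Rle_abs _) _.
  apply: Rle_trans (sumR_abs _ _) _; apply: sumR_le => i _; rewrite Rabs_mult.
  by have := hu i; have := Rabs_pos (x i); have := Rabs_pos (u i); nra.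
have nz x : 1 <= \big[Rplus/0]_(i < n.+2) Rabs (x i) -> nonzero_vec x.
  move=> h; apply: contrapT => /forallNP h0; move: h.
  rewrite big1; first lra.
  by move=> i _; have /contrapT -> := h0 i; rewrite Rabs_R0.
apply: contrapT => /forallNP hno.
apply: (@tucker _ (@neg n.+2) (@bary n.+2) (basis n.+2) n.+1 m lab).
- exact: bary_neg.
- by move=> k; exact: negK.
- by move=> x; exact: ltn_ord.
- move=> k s x kn ss xs; have xnz := nz x (hnorm k kn s ss x xs).
  have eG := Godd _ xnz.
  (* [amax] is applied to the same vector of absolute values at antipodal points, so ties are broken
     alike. *)
  have ej : jx (neg x) = jx x.
    rewrite /jx eG; congr amax; apply: funext => i.
    by rewrite /neg Rabs_Ropp.
  rewrite /lab /opp_label ej /= eG /neg; congr pair.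
  (* A vanishing coordinate would get the sign [false] at both antipodes. *)
  have g0 : G x (jx x) <> 0.
    move=> e0; have [i gi] := Gnz x xnz; apply: gi.
    have := hmax (fun i => Rabs (G x i)) i; rewrite -/(jx x) e0 Rabs_R0.
    by split_Rabs; lra.
  by case: (Rdichotomy _ _ g0) => g1; case: Rlt_dec => h1; case: Rlt_dec => h2 //=;
    exfalso; lra.
- move=> k s x y kn ss xs ys [ej es].
  move/forallNP: (hno x) => /(_ y); apply; split.
    exact: (hbox k kn s ss x xs).
  split; first by apply: (hdim k kn s ss).
  split; first exact: (hnorm k kn s ss x xs).
  exists (jx x); split; first exact: (hmax (fun i => Rabs (G x i))).
  move: es; rewrite -(ord_inj ej).
  by case: Rlt_dec => h1; case: Rlt_dec => h2 //= _; split_Rabs; lra.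
Qed.

(** If [G] has no zero, complementary pairs of finer and finer subdivisions converge along a
    subsequence to a common point [l]. It is nonzero by the bound on the sum of absolute values, and
    continuity forces [G l = 0]. *)
Theorem borsuk_ulam (n : nat) (G : ('I_n.+2 -> R) -> 'I_n.+1 -> R) :
  (forall p, nonzero_vec p -> G (neg p) = neg (G p)) ->
  (forall (p : nat -> 'I_n.+2 -> R) l, nonzero_vec l ->
     (forall i, Un_cv (fun m => p m i) (l i)) ->
     forall j, Un_cv (fun m => G (p m) j) (G l j)) ->
  exists p, nonzero_vec p /\ forall j, G p j = 0.
Proof.
move=> Godd Gcont; apply: contrapT => /forallNP hno.
have Gnz p : nonzero_vec p -> nonzero_vec (G p).
  move=> pnz; apply: contrapT => /forallNP h; apply: (hno p); split=> // j.
  by apply: contrapT; apply: h.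
have [x hx] := choice (complementary_pairs Godd Gnz).
have {hx} [y hxy] := choice hx.
have [phi [l [hphi hl]]] :=
  bolzano_weierstrass_vec (fun m => (hxy m).1).
pose q := INR n.+1 / INR n.+2.
have hq : 0 <= q < 1.
  have n1 : 0 < INR n.+1 by apply/lt_0_INR/ltP.
  have e : q * INR n.+2 = INR n.+1 by rewrite /q (S_INR n.+1); field; lra.
  by move: e; rewrite (S_INR n.+1); nra.
have hy i : Un_cv (fun m => y (phi m) i) (l i).
  have h0 : Un_cv (fun m => x (phi m) i - y (phi m) i) 0.
    apply: (@Un_cv_squeeze0 _ (fun m => q ^ (phi m) * 2)).
      by move=> m; rewrite Rminus_0_r; case: (hxy (phi m)) => _ [].
    by apply: (@Un_cv_sub (fun m => q ^ m * 2)) => //; apply: Un_cv_geom.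
  have := CV_minus _ _ _ _ (hl i) h0; rewrite Rminus_0_r.
  by congr Un_cv; apply: funext => m; lra.
have lnz : nonzero_vec l.
  have : 1 <= \big[Rplus/0]_(i < n.+2) Rabs (l i).
    apply: Rle_cv_lim (Un_cv_const 1) (Un_cv_sum _ (fun i => cv_cvabs _ _ (hl i))).
    by move=> m; case: (hxy (phi m)) => _ [_ []].
  move=> h; apply: contrapT => /forallNP h0; move: h.
  rewrite big1; first lra.
  by move=> i _; have /contrapT -> := h0 i; rewrite Rabs_R0.
apply: (hno l); split=> // i.
(* The index [j] of the pair varies with [m], so the sum over all coordinates is used as the
   bound. *)
pose w m := \big[Rplus/0]_(j < n.+1) Rabs (G (x (phi m)) j - G (y (phi m)) j).
have hw : Un_cv w 0.
  rewrite -[0](_ : \big[Rplus/0]_(j < n.+1) Rabs (G l j - G l j) = 0).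
    apply: Un_cv_sum => j; apply: cv_cvabs.
    by apply: CV_minus; apply: Gcont.
  by rewrite big1 // => j _; rewrite Rminus_diag Rabs_R0.
have : Rabs (G l i) <= 0.
  apply: Rle_cv_lim (cv_cvabs _ _ (Gcont _ _ lnz hl i)) hw => m.
  have [_ [_ [_ [j [h1 h2]]]]] := hxy (phi m).
  apply: Rle_trans (h1 i) _; apply: Rle_trans h2 _.
  rewrite /w (bigD1 j) //= -[X in X <= _]Rplus_0_r; apply: Rplus_le_compat_l.
  by elim/big_ind: _ => [|a b|k _]; [lra|lra|exact: Rabs_pos].
by split_Rabs; lra.
Qed.

(** * Measures of halfspaces *)

Lemma inner_dist (d : nat) (u x y : pt d) (r : R) :
  (forall i, Rabs (y i - x i) <= r) ->
  Rabs (inner u y - inner u x) <= \big[Rplus/0]_(i < d) Rabs (u i) * r.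
Proof.
move=> h.
have -> : inner u y - inner u x = \big[Rplus/0]_(i < d) (u i * (y i - x i)).
  rewrite (eq_bigr (fun i => u i * y i + - (u i * x i))); last by move=> *; lra.
  by rewrite big_split /= sumR_opp.
apply: Rle_trans (sumR_abs _ _) _; rewrite big_distrl /=.
apply: sumR_le => i _; rewrite Rabs_mult.
by apply: Rmult_le_compat_l => //; apply: Rabs_pos.
Qed.

Lemma open_inner_lt (d : nat) (u : pt d) (c : R) :
  is_open (fun x => inner u x < c).
Proof.
move=> x hx; pose S := \big[Rplus/0]_(i < d) Rabs (u i).
have S0 : 0 <= S.
  by rewrite /S; elim/big_ind: _ => [|a b|i _]; [lra|lra|exact: Rabs_pos].
(* A shift by less than [r] in each coordinate changes [inner u] by at most [S * r]; the divisor
   [S + 1] is positive even for [u = 0]. *)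
have d0 : 0 < (c - inner u x) / (S + 1).
  by apply: Rmult_lt_0_compat; [lra|apply: Rinv_0_lt_compat; lra].
exists ((c - inner u x) / (S + 1)); split=> // y hy.
have := @inner_dist _ u _ _ _ (fun i => Rlt_le _ _ (hy i)); rewrite -/S.
have : (c - inner u x) / (S + 1) * (S + 1) = c - inner u x by field; lra.
by split_Rabs; nra.
Qed.

Lemma borel_inner_lt (d : nat) (u : pt d) (c : R) :
  borel (fun x => inner u x < c).
Proof. exact/borel_open/open_inner_lt. Qed.

Lemma borel_halfspace (d : nat) (u : pt d) (c : R) : borel (halfspace u c).
Proof.
apply: borel_ext (borel_compl (borel_inner_lt u c)) _ => x.
by rewrite /halfspace; lra.
Qed.

Lemma borel_False (d : nat) : borel (fun _ : pt d => False).
Proof. exact: borel_open. Qed.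

Lemma borel_or (d : nat) (A B : pt d -> Prop) :
  borel A -> borel B -> borel (fun x => A x \/ B x).
Proof.
move=> bA bB.
apply: (@borel_ext _ (fun x => exists n : nat, (if n is 0%N then A else B) x)).
  by apply: borel_cunion => -[].
move=> x; split=> [[[|n]] h|[h|h]];
  [by left|by right|by exists 0%N|by exists 1%N].
Qed.

Lemma borel_and (d : nat) (A B : pt d -> Prop) :
  borel A -> borel B -> borel (fun x => A x /\ B x).
Proof.
move=> bA bB.
apply: borel_ext (borel_compl (borel_or (borel_compl bA) (borel_compl bB))) _.
move=> x; split=> [h|[a b] [] //].
by split; apply: contrapT => h'; apply: h; [left|right].
Qed.

Lemma neg_inner (d : nat) (u x : pt d) : inner (neg u) x = - inner u x.
Proof. by rewrite /inner -sumR_opp; apply: eq_bigr => i _; rewrite /neg; lra. Qed.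

Lemma borel_hyperplane (d : nat) (u : pt d) (c : R) :
  borel (fun x => inner u x = c).
Proof.
apply: borel_ext (borel_and (borel_halfspace u c)
  (borel_halfspace (neg u) (- c))) _ => x.
by rewrite /halfspace neg_inner; lra.
Qed.

(** * Probability measures *)

Lemma measure_ext (d : nat) (mu : (pt d -> Prop) -> R) (A B : pt d -> Prop) :
  (forall x, A x <-> B x) -> mu A = mu B.
Proof. by move=> h; congr mu; apply: funext => x; apply: propext. Qed.

(** For a sequence of empty sets, a constant series [a + a + ...] converges to [a], hence
    [a = 0]. *)
Lemma measure_False (d : nat) (mu : (pt d -> Prop) -> R) :
  prob_measure mu -> mu (fun _ => False) = 0.
Proof.
move=> [m0 [_ madd]].
have := madd (fun _ _ => False) (fun _ => borel_False d) (fun _ _ _ _ h _ => h).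
rewrite (@measure_ext _ mu (fun _ => exists _, _) (fun _ => False)); last first.
  by move=> x; split=> // -[].
set a := mu _; move=> h; have a0 : 0 <= a := m0 _ (borel_False d).
case: (Req_dec a 0) => // an0; have [|N hN] := h a; first lra.
have := hN N.+1 (Nat.le_succ_diag_r N); rewrite sum_cte /R_dist !S_INR.
have := pos_INR N; split_Rabs; nra.
Qed.

Lemma measure_or (d : nat) (mu : (pt d -> Prop) -> R) (A B : pt d -> Prop) :
  prob_measure mu -> borel A -> borel B -> (forall x, A x -> B x -> False) ->
  mu (fun x => A x \/ B x) = mu A + mu B.
Proof.
move=> pm bA bB dAB; have m0 := measure_False pm; case: pm => _ [_ madd].
pose C (n : nat) : pt d -> Prop :=
  match n with 0%N => A | 1%N => B | _ => fun _ => False end.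
have bC n : borel (C n) by case: n => [|[|n]] //; apply: borel_False.
have dC m n x : m <> n -> C m x -> C n x -> False.
  case: m n => [|[|m]] [|[|n]] //= _ h1 h2; exact: (dAB x).
have := madd C bC dC.
rewrite (@measure_ext _ mu (fun x => exists n, C n x) (fun x => A x \/ B x)).
  move=> h; apply: uniqueness_sum h _ => e e0; exists 1%N => n n1.
  have -> : sum_f_R0 (fun n => mu (C n)) n = mu A + mu B.
    case: n n1 => [/leP //|n _]; elim: n => [//|n IHn].
    by rewrite tech5 IHn /= m0; lra.
  by rewrite /R_dist Rminus_diag Rabs_R0.
move=> x; split=> [[[|[|n]]] //= h|[h|h]];
  [by left|by right|by exists 0%N|by exists 1%N].
Qed.

Lemma measure_diff (d : nat) (mu : (pt d -> Prop) -> R) (A B : pt d -> Prop) :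
  prob_measure mu -> borel A -> borel B -> (forall x, A x -> B x) ->
  mu (fun x => B x /\ ~ A x) = mu B - mu A.
Proof.
move=> pm bA bB sAB.
have := measure_or pm bA (borel_and bB (borel_compl bA)) (fun x a b => b.2 a).
rewrite (@measure_ext _ mu (fun x => _ \/ _) B); first lra.
move=> x; split=> [[/sAB|[]]//|b].
by case: (pselect (A x)) => a; [left|right].
Qed.

Lemma measure_le (d : nat) (mu : (pt d -> Prop) -> R) (A B : pt d -> Prop) :
  prob_measure mu -> borel A -> borel B -> (forall x, A x -> B x) ->
  mu A <= mu B.
Proof.
move=> pm bA bB /(measure_diff pm bA bB).
by have := pm.1 _ (borel_and bB (borel_compl bA)); lra.
Qed.

Lemma measure_compl (d : nat) (mu : (pt d -> Prop) -> R) (A : pt d -> Prop) :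
  prob_measure mu -> borel A -> mu (fun x => ~ A x) = 1 - mu A.
Proof.
move=> pm bA; have bT := borel_compl (borel_False d).
have -> : 1 = mu (fun _ => ~ False).
  by rewrite -pm.2.1; apply: measure_ext => x; split=> // _ [].
rewrite -(measure_diff pm bA bT (fun _ _ f => f)).
by apply: measure_ext => x; split=> [h|[]//]; split.
Qed.

Lemma measure_subadd (d : nat) (mu : (pt d -> Prop) -> R)
    (A B C : pt d -> Prop) :
  prob_measure mu -> borel A -> borel B -> borel C ->
  (forall x, C x -> A x \/ B x) -> mu C <= mu A + mu B.
Proof.
move=> pm bA bB bC h; have bBA := borel_and bB (borel_compl bA).
have h1 : mu (fun x => B x /\ ~ A x) <= mu B by apply: measure_le => // x [].
have h2 : mu C <= mu (fun x => A x \/ (B x /\ ~ A x)).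
  apply: measure_le => //; first exact: borel_or.
  move=> x /h[a|b]; first by left.
  by case: (pselect (A x)) => a; [left|right].
have := measure_or pm bA bBA (fun x a b => b.2 a); lra.
Qed.

(** The differences [D n] partition [U 0] up to the null intersection, and their partial sums
    telescope to [mu (U 0) - mu (U n.+1)]. *)
Lemma measure_decr_cv (d : nat) (mu : (pt d -> Prop) -> R)
    (U : nat -> pt d -> Prop) :
  prob_measure mu -> (forall n, borel (U n)) ->
  (forall n x, U n.+1 x -> U n x) -> mu (fun x => forall n, U n x) = 0 ->
  Un_cv (fun n => mu (U n)) 0.
Proof.
move=> pm bU dU mI.
have dU' m n x : (m <= n)%N -> U n x -> U m x.
  move=> /subnKC <-; elim: (n - m)%N => [|k IHk]; first by rewrite addn0.
  by rewrite addnS => /dU.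
pose D n x := U n x /\ ~ U n.+1 x.
have bD n : borel (D n) by apply: borel_and => //; apply: borel_compl.
have dD m n x : m <> n -> D m x -> D n x -> False.
  move=> /eqP; rewrite neq_ltn => /orP[] mn [a b] [a' b'].
    by apply: b; apply: dU' mn a'.
  by apply: b'; apply: dU' mn a.
have bI : borel (fun x => forall n, U n x).
  apply: borel_ext (borel_compl (borel_cunion (fun n => borel_compl (bU n)))) _.
  move=> x; split=> [h n|h [n]]; last by apply; apply: h.
  by apply: contrapT => hn; apply: h; exists n.
have := pm.2.2 D bD dD.
rewrite (@measure_ext _ mu _ (fun x => U 0%N x /\ ~ forall n, U n x)).
  rewrite measure_diff // mI => hs e e0; have [N hN] := hs e e0.
  exists N.+1 => -[/leP //|n] /leP nN; have := hN n (elimT (@leP N n) nN).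
  have -> : sum_f_R0 (fun n => mu (D n)) n = mu (U 0%N) - mu (U n.+1).
    elim: n {nN} => [|n IHn]; first by rewrite /= measure_diff //; apply: dU.
    by rewrite tech5 IHn /D measure_diff //; [lra|apply: dU].
  by rewrite /R_dist; split_Rabs; lra.
move=> x; split=> [[n [a b]]|[u0 /existsNP[n hn]]].
  by split=> [|/(_ n.+1)//]; apply: dU' a.
elim: n hn => [//|n IHn] hn.
by case: (pselect (U n x)) => [h|/IHn//]; exists n.
Qed.

(** The symmetric difference [E m] of [A m] and [B] lies in the tail union [U m]. The sets [U m]
    decrease to the points lying in infinitely many [E m], all of which belong to [N]. *)
Lemma measure_cv (d : nat) (mu : (pt d -> Prop) -> R)
    (A : nat -> pt d -> Prop) (B N : pt d -> Prop) :
  prob_measure mu -> (forall n, borel (A n)) -> borel B -> borel N ->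
  mu N = 0 ->
  (forall x, ~ N x -> exists n, forall m, (n <= m)%N -> (A m x <-> B x)) ->
  Un_cv (fun n => mu (A n)) (mu B).
Proof.
move=> pm bA bB bN mN h.
pose E m x := (A m x /\ ~ B x) \/ (B x /\ ~ A m x).
have bE m : borel (E m).
  by apply: borel_or; apply: borel_and => //; apply: borel_compl.
pose U n x := exists m, E (n + m)%N x.
have bU n : borel (U n) by apply: borel_cunion.
apply: (@Un_cv_squeeze0 _ (fun n => mu (U n))).
  move=> m; have EU x : E m x -> U m x by exists 0%N; rewrite addn0.
  have h1 : mu (A m) <= mu B + mu (U m).
    apply: measure_subadd => // x a; case: (pselect (B x)) => b; first by left.
    by right; apply: EU; left.
  have h2 : mu B <= mu (A m) + mu (U m).
    apply: measure_subadd => // x b; case: (pselect (A m x)) => a; first by left.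
    by right; apply: EU; right.
  by split_Rabs; lra.
apply: measure_decr_cv => //.
  by move=> n x [m hm]; exists m.+1; rewrite addnS.
have bI : borel (fun x => forall n, U n x).
  apply: borel_ext (borel_compl (borel_cunion (fun n => borel_compl (bU n)))) _.
  move=> x; split=> [hx n|hx [n]]; last by apply; apply: hx.
  by apply: contrapT => hn; apply: hx; exists n.
have h0 := pm.1 _ bI.
have : mu (fun x => forall n, U n x) <= mu N; last lra.
apply: measure_le => // x hU; apply: contrapT => /h[n hn].
have [m] := hU n; have [ab ba] := hn (n + m)%N (leq_addr _ _).
by case=> [[/ab]|[/ba]].
Qed.

(** * Hyperplanes are Lebesgue null *)

Lemma sum_f_R0_big (f : nat -> R) (N : nat) :
  sum_f_R0 f N = \big[Rplus/0]_(n <- iota 0 N.+1) f n.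
Proof.
elim: N => [|N IHN]; first by rewrite /= big_cons big_nil; lra.
by rewrite tech5 IHN -(addn1 N.+1) iotaD big_cat big_seq1.
Qed.

Definition box_cover (d : nat) (A : pt d -> Prop)
    (L : seq (('I_d -> R) * ('I_d -> R))) (e : R) : Prop :=
  {in L, forall ab, forall i, ab.1 i <= ab.2 i} /\
  (forall x, A x -> exists2 ab, ab \in L & forall i, ab.1 i <= x i <= ab.2 i) /\
  \big[Rplus/0]_(ab <- L) box_vol ab.1 ab.2 <= e.

Lemma box_vol_ge0 (d : nat) (a b : pt d) :
  (forall i, a i <= b i) -> 0 <= box_vol a b.
Proof.
move=> h; rewrite /box_vol; elim/big_ind: _ => [|x y|i _]; first lra.
  exact: Rmult_le_pos.
by have := h i; lra.
Qed.

(** The finite covers of the [A p], with volumes at most [e / 2 ^ (p + 1)], are concatenated into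
    one sequence of boxes. Every cover is made nonempty, so the first [n.+1] of them contain an
    entry with index [n]. *)
Lemma lebesgue_null_cunion (d : nat) (A : nat -> pt d.+1 -> Prop) :
  (forall p e, 0 < e -> exists L, box_cover (A p) L e) ->
  lebesgue_null (fun x => exists p, A p x).
Proof.
move=> hA e e0.
have hL p : exists L, box_cover (A p) L (e * (1 / 2) ^ p.+1) /\ (0 < size L)%N.
  have [|L [h1 [h2 h3]]] := hA p (e * (1 / 2) ^ p.+1).
    by apply: Rmult_lt_0_compat => //; apply: pow_lt; lra.
  (* The added box is a point, of volume 0 because the dimension is positive. *)
  exists ((fun _ => 0, fun _ => 0) :: L); split=> //; split.
    by move=> ab; rewrite inE => /predU1P[-> i /=|/h1 //]; lra.
  split=> [x /h2[ab abL hx]|]; first by exists ab => //; rewrite inE abL orbT.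
  rewrite big_cons /= (_ : box_vol _ _ = 0) ?Rplus_0_l //.
  by rewrite /box_vol (bigD1 ord0) //= Rminus_diag Rmult_0_l.
have {hL} [L hL] := choice hL.
pose pre P := flatten [seq L p | p <- iota 0 P].
have preS P : pre P.+1 = pre P ++ L P.
  by rewrite /pre -(addn1 P) iotaD map_cat flatten_cat /= cats0.
have size_pre P : (P <= size (pre P))%N.
  elim: P => // P IHP; rewrite preS size_cat -(addn1 P).
  by apply: leq_add IHP _; case: (hL P).
pose dflt : ('I_d.+1 -> R) * ('I_d.+1 -> R) := (fun _ => 0, fun _ => 0).
(* Prefixes extend each other, so [box n] is the entry with index [n] of every prefix that is long
   enough. *)
have stable P Q k : (P <= Q)%N -> (k < size (pre P))%N ->
    nth dflt (pre Q) k = nth dflt (pre P) k.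
  move=> /subnKC <- kP; elim: (Q - P)%N => [|j IHj]; first by rewrite addn0.
  rewrite addnS preS nth_cat IHj.
  suff -> : (k < size (pre (P + j)))%N by [].
  elim: j {IHj} => [|j IHj]; first by rewrite addn0.
  by rewrite addnS preS size_cat ltn_addr.
pose box n := nth dflt (pre n.+1) n.
have pre_le P : {in pre P, forall ab, forall i, ab.1 i <= ab.2 i}.
  by move=> ab /flattenP[x /mapP[p _ ->] abL]; have [[h _] _] := hL p; apply: h.
have box_in n : box n \in pre n.+1 by rewrite mem_nth // size_pre.
exists (fun n => (box n).1), (fun n => (box n).2); split; last split.
- by move=> n; apply: pre_le (box_in n).
- move=> x [p Apx]; have [[_ [h _]] _] := hL p; have [ab abL hx] := h x Apx.
  have abp : ab \in pre p.+1 by rewrite preS mem_cat abL orbT.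
  exists (index ab (pre p.+1)); set k := index _ _.
  suff -> : box k = ab by [].
  have kp : (k < size (pre p.+1))%N by rewrite index_mem.
  rewrite /box -(stable _ (maxn k.+1 p.+1)) ?leq_maxl ?size_pre //.
  by rewrite (stable p.+1) ?leq_maxr // nth_index.
- move=> N; rewrite sum_f_R0_big.
  have -> : \big[Rplus/0]_(n <- iota 0 N.+1) box_vol (box n).1 (box n).2
      = \big[Rplus/0]_(ab <- take N.+1 (pre N.+1)) box_vol ab.1 ab.2.
    rewrite -(map_nth_iota0 dflt) ?size_pre // big_map; apply: eq_big_seq => n.
    rewrite mem_iota add0n => /= nN.
    by rewrite /box (@stable n.+1 N.+1) ?size_pre.
  apply: (Rle_trans _ (\big[Rplus/0]_(ab <- pre N.+1) box_vol ab.1 ab.2)).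
    rewrite -{2}(cat_take_drop N.+1 (pre N.+1)) big_cat /=.
    rewrite -[X in X <= _]Rplus_0_r; apply: Rplus_le_compat_l.
    rewrite big_seq; elim/big_ind: _ => [|a b|ab abd]; [lra|lra|].
    by apply: box_vol_ge0; apply: pre_le (mem_drop abd).
  suff H P : \big[Rplus/0]_(ab <- pre P) box_vol ab.1 ab.2
      <= e * (1 - (1 / 2) ^ P).
    by apply: Rle_trans (H _) _;
      have : 0 < (1 / 2) ^ N.+1; [apply: pow_lt; lra|nra].
  elim: P => [|P IHP]; first by rewrite big_nil /=; lra.
  rewrite preS big_cat /=; have [[_ [_ h]] _] := hL P.
  by apply: Rle_trans (Rplus_le_compat _ _ _ _ IHP h) _; rewrite /=; lra.
Qed.

Lemma grid_index (k : nat) (h t : R) :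
  0 <= t <= INR k.+1 * h ->
  exists q : 'I_k.+1, INR q * h <= t <= INR q * h + h.
Proof.
elim: k => [|k IHk] ht; first by exists ord0; move: ht => /=; lra.
case: (Rle_lt_dec t (INR k.+1 * h)) => tk.
  have [//|q hq] := IHk; first lra.
  by exists (widen_ord (leqnSn _) q).
exists ord_max; move: ht; rewrite (S_INR k.+1) [nat_of_ord _]/=; lra.
Qed.

Lemma INR_expn (k n : nat) : INR (k ^ n)%N = INR k ^ n.
Proof. by elim: n => [//|n IHn]; rewrite expnS mult_INR IHn. Qed.

(* The cube is cut into [k ^ d] columns in the direction of [i0]; above each of
   them the hyperplane has height [O(1/k)]. *)
Lemma hyperplane_cube_cover (d : nat) (u : pt d.+1) (c M e : R) (i0 : 'I_d.+1) :
  u i0 <> 0 -> 0 < M -> 0 < e ->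
  exists L, box_cover (fun x => inner u x = c /\ forall i, - M <= x i <= M) L e.
Proof.
move=> u0 M0 e0.
have ua0 : 0 < Rabs (u i0) by apply: Rabs_pos_lt.
pose S := \big[Rplus/0]_(j < d) Rabs (u (lift i0 j)).
have S0 : 0 <= S.
  by rewrite /S; elim/big_ind: _ => [|a b|i _]; [lra|lra|exact: Rabs_pos].
(* [C / (k + 1)] will be the total volume of the boxes. *)
pose C := (2 * M) ^ d * (2 * (2 * M * S / Rabs (u i0))).
have [k hk] : exists k, C <= e * INR k.+1.
  have [N hN] := INR_unbounded (C / e); exists N.
  have -> : C = e * (C / e) by field; lra.
  by apply: Rmult_le_compat_l; lra.
have k0 : 0 < INR k.+1 by apply/lt_0_INR/ltP.
pose h := 2 * M / INR k.+1.
have hkh : INR k.+1 * h = 2 * M by rewrite /h; field; lra.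
have h0 : 0 < h by apply: Rmult_lt_0_compat; [lra|exact: Rinv_0_lt_compat].
(* Inside a column the other coordinates vary by at most [h], so the height of the hyperplane
   differs by at most [r] from its height [y q] over the corner [lo q]. *)
pose r := h * S / Rabs (u i0).
have r0 : 0 <= r.
  apply: Rmult_le_pos; last exact/Rlt_le/Rinv_0_lt_compat.
  by apply: Rmult_le_pos => //; lra.
pose lo (q : {ffun 'I_d -> 'I_k.+1}) j := - M + INR (q j) * h.
pose y q := (c - \big[Rplus/0]_(j < d) (u (lift i0 j) * lo q j)) / u i0.
pose bx q : ('I_d.+1 -> R) * ('I_d.+1 -> R) :=
  (fun i => if unlift i0 i is Some j then lo q j else y q - r,
   fun i => if unlift i0 i is Some j then lo q j + h else y q + r).
exists [seq bx q | q <- enum {ffun 'I_d -> 'I_k.+1}]; split; last split.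
- by move=> _ /mapP[q _ ->] i /=; case: unlift => [j|]; lra.
- move=> x [hx xM].
  have hq j : exists q : 'I_k.+1,
      - M + INR q * h <= x (lift i0 j) <= - M + INR q * h + h.
    have [|q hq] := @grid_index k h (x (lift i0 j) + M).
      by have := xM (lift i0 j); lra.
    by exists q; lra.
  have {hq} [q hq] := choice hq.
  pose qf : {ffun 'I_d -> 'I_k.+1} := [ffun j => q j].
  have qfE j : qf j = q j by rewrite ffunE.
  exists (bx qf); first by rewrite map_f ?mem_enum.
  move=> i /=; case: unliftP => [j|] ->; first by rewrite /lo qfE.
  suff H : Rabs (x i0 - y qf) <= r.
    have := Rle_abs (x i0 - y qf).
    by have := Rle_abs (- (x i0 - y qf)); rewrite Rabs_Ropp; lra.
  have := @inner_dist _ (fun j => u (lift i0 j)) (lo qf)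
    (fun j => x (lift i0 j)) h.
  rewrite -/S => H; have {}H :
      Rabs (inner (fun j => u (lift i0 j)) (fun j => x (lift i0 j))
      - inner (fun j => u (lift i0 j)) (lo qf)) <= S * h.
    by apply: H => j; rewrite /lo qfE; apply: Rabs_le; have := hq j; lra.
  have e1 : c = u i0 * x i0
      + inner (fun j => u (lift i0 j)) (fun j => x (lift i0 j)).
    by rewrite -hx /inner (bigD1_ord i0).
  have -> : x i0 - y qf
      = - (inner (fun j => u (lift i0 j)) (fun j => x (lift i0 j))
      - inner (fun j => u (lift i0 j)) (lo qf)) / u i0.
    by rewrite /y -/(inner (fun j => u (lift i0 j)) (lo qf)) e1; field.
  rewrite /Rdiv Rabs_mult Rabs_Ropp Rabs_inv /r (Rmult_comm h).
  apply: Rmult_le_compat_r H; exact/Rlt_le/Rinv_0_lt_compat.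
- rewrite big_map.
  have vol q : box_vol (bx q).1 (bx q).2 = 2 * r * h ^ d.
    rewrite /box_vol (bigD1_ord i0) //= unlift_none.
    rewrite (eq_bigr (fun=> h)); last by move=> j _; rewrite liftK; lra.
    rewrite big_const_ord; have -> : iter d (Rmult h) 1 = h ^ d.
      by elim: (d) => //= n ->.
    lra.
  rewrite (eq_bigr _ (fun q _ => vol q)) sumR_const -cardE card_ffun !card_ord.
  rewrite INR_expn.
  have -> : INR k.+1 ^ d * (2 * r * h ^ d) = (INR k.+1 * h) ^ d * (2 * r).
    by rewrite Rpow_mult_distr; lra.
  have -> : (INR k.+1 * h) ^ d * (2 * r) = C / INR k.+1.
    by rewrite hkh /C /r /h; field; lra.
  apply: (Rmult_le_reg_r _ _ _ k0).
  by have -> : C / INR k.+1 * INR k.+1 = C by field; lra.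
Qed.

(** The cubes of half-side [p + 1] exhaust the space, and the part of the hyperplane in each has
    arbitrarily small finite covers. In dimension 0 there is no nonzero [u]. *)
Lemma hyperplane_null (d : nat) (u : pt d) (c : R) :
  nonzero_vec u -> lebesgue_null (fun x => inner u x = c).
Proof.
case: d u => [|d] u [i0 u0]; first by case: i0 u0.
have H := @lebesgue_null_cunion d
  (fun p x => inner u x = c /\ forall i, - INR p.+1 <= x i <= INR p.+1) _.
move=> e e0; have [|a [b [h1 [h2 h3]]]] := H _ e e0.
  by move=> p e' e'0; apply: (hyperplane_cube_cover _ u0) => //;
    apply/lt_0_INR/ltP.
exists a, b; split=> //; split=> // x hx; apply: h2.
pose S := \big[Rplus/0]_(i < d.+1) Rabs (x i).
have [N hN] := INR_unbounded S.
exists N; split=> // i; have : Rabs (x i) <= S; last by split_Rabs; lra.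
rewrite /S (bigD1 i) //= -[X in X <= _]Rplus_0_r; apply: Rplus_le_compat_l.
by elim/big_ind: _ => [|a' b'|k _]; [lra|lra|exact: Rabs_pos].
Qed.

(** * Halfspaces as points of R^(d+1) *)

Definition normal (d : nat) (p : 'I_d.+1 -> R) : pt d :=
  fun j => p (lift ord0 j).

(** Coordinate 0 is the threshold. A nonzero [p] with zero normal is a pole: it gives the empty set
    for a positive threshold and the whole space for a negative one. *)
Definition halfspace_of (d : nat) (p : 'I_d.+1 -> R) : pt d -> Prop :=
  halfspace (normal p) (p ord0).

Lemma normal_zero (d : nat) (p : 'I_d.+1 -> R) :
  ~ nonzero_vec (normal p) -> nonzero_vec p ->
  (forall x, inner (normal p) x = 0) /\ p ord0 <> 0.
Proof.
move=> /forallNP h [i pi0].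
have n0 j : p (lift ord0 j) = 0 by apply: contrapT; apply: h.
split=> [x|p0].
  by rewrite /inner big1 // => j _; rewrite /normal n0 Rmult_0_l.
by apply: pi0; case: (unliftP ord0 i) => [j|] ->; rewrite ?n0.
Qed.

Lemma measure_boundary (d : nat) (mu : (pt d -> Prop) -> R) (p : 'I_d.+1 -> R) :
  prob_measure mu -> abs_continuous mu -> nonzero_vec p ->
  mu (fun x => inner (normal p) x = p ord0) = 0.
Proof.
move=> pm ac pnz; case: (pselect (nonzero_vec (normal p))) => un.
  by apply: ac; [exact: borel_hyperplane|exact: hyperplane_null].
have [h0 p0] := normal_zero un pnz; rewrite -(measure_False pm).
by apply: measure_ext => x; rewrite h0; split=> // e; apply: p0.
Qed.

(** The halfspace of [neg p] is the complement of that of [p] together with the bounding hyperplane,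
    which has measure 0. *)
Lemma measure_halfspace_neg (d : nat) (mu : (pt d -> Prop) -> R) (p : 'I_d.+1 -> R) :
  prob_measure mu -> abs_continuous mu -> nonzero_vec p ->
  mu (halfspace_of (neg p)) = 1 - mu (halfspace_of p).
Proof.
move=> pm ac pnz; have bh := borel_halfspace (normal p) (p ord0).
rewrite -(measure_compl pm bh) -[RHS]Rplus_0_r.
rewrite -(measure_boundary pm ac pnz) -measure_or //.
- apply: measure_ext => x; rewrite /halfspace_of /halfspace.
  rewrite -[normal (neg p)]/(neg (normal p)) neg_inner /neg.
  by split=> [h|[]]; lra.
- exact: borel_compl.
- exact: borel_hyperplane.
- by move=> x; rewrite /halfspace; lra.
Qed.

(** At a point off the bounding hyperplane of [l], the defining expression [D (p m)] eventually has
    the sign of [D l], so the indicators converge almost everywhere. *)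
Lemma measure_halfspace_cv (d : nat) (mu : (pt d -> Prop) -> R)
    (p : nat -> 'I_d.+1 -> R) (l : 'I_d.+1 -> R) :
  prob_measure mu -> abs_continuous mu -> nonzero_vec l ->
  (forall i, Un_cv (fun m => p m i) (l i)) ->
  Un_cv (fun m => mu (halfspace_of (p m))) (mu (halfspace_of l)).
Proof.
move=> pm ac lnz hp.
apply: (@measure_cv _ _ _ _ (fun x => inner (normal l) x = l ord0)) => //.
- by move=> n; exact: borel_halfspace.
- exact: borel_halfspace.
- exact: borel_hyperplane.
- exact: measure_boundary.
move=> x xl; pose D q := inner (normal q) x - q ord0.
have Dl : 0 < Rabs (D l) by apply: Rabs_pos_lt; rewrite /D; lra.
have cD : Un_cv (fun m => D (p m)) (D l).
  apply: CV_minus => //; apply: Un_cv_sum => i.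
  by apply: CV_mult (Un_cv_const _); exact: hp.
have [N hN] := cD _ Dl; exists N => m /leP /hN; rewrite /R_dist.
by rewrite /halfspace_of /halfspace; move: Dl; rewrite /D; split_Rabs; lra.
Qed.

Lemma measure_halfspace_pole (d : nat) (p : 'I_d.+1 -> R) :
  ~ nonzero_vec (normal p) -> nonzero_vec p ->
  (forall mu, prob_measure mu -> mu (halfspace_of p) = 0) \/
  (forall mu, prob_measure mu -> mu (halfspace_of p) = 1).
Proof.
move=> un pnz; have [h0 p0] := normal_zero un pnz.
case: (Rdichotomy _ _ p0) => h; [right|left] => mu pm.
  rewrite -pm.2.1; apply: measure_ext => x.
  by rewrite /halfspace_of /halfspace h0; split=> // _; lra.
rewrite -(measure_False pm); apply: measure_ext => x.
by rewrite /halfspace_of /halfspace h0; split=> // *; lra.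
Qed.

(** * The cutoff function and the common value *)

Lemma Un_cv_prod (T : Type) (s : seq T) (f : nat -> T -> R) (l : T -> R) :
  (forall i, Un_cv (fun m => f m i) (l i)) ->
  Un_cv (fun m => \big[Rmult/1]_(i <- s) f m i) (\big[Rmult/1]_(i <- s) l i).
Proof.
move=> h; elim: s => [|x s IHs].
  rewrite big_nil (_ : (fun m => _) = fun=> 1); first exact: Un_cv_const.
  by apply: funext => m; rewrite big_nil.
rewrite big_cons (_ : (fun m => _)
  = (fun m => f m x * \big[Rmult/1]_(i <- s) f m i)); first exact: CV_mult.
by apply: funext => m; rewrite big_cons.
Qed.

Lemma Un_cv_Rmax0 (u : nat -> R) (l : R) :
  Un_cv u l -> Un_cv (fun m => Rmax 0 (u m)) (Rmax 0 l).
Proof.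
move=> h e e0; have [N hN] := h e e0; exists N => m /hN.
by rewrite /R_dist /Rmax; do 2![case: Rle_dec => ?]; split_Rabs; lra.
Qed.

(** This is [phi] of the introduction: a product of positive parts, continuous and positive exactly
    where all the measures are below [eps]. *)
Definition bump (d : nat) (eps : R) (mu : nat -> (pt d -> Prop) -> R)
    (p : 'I_d.+1 -> R) : R :=
  \big[Rmult/1]_(i < d.+1) Rmax 0 (eps - mu i (halfspace_of p)).

Lemma bump_gt0 (d : nat) eps (mu : nat -> (pt d -> Prop) -> R) p :
  (forall i, (i <= d)%N -> mu i (halfspace_of p) < eps) -> 0 < bump eps mu p.
Proof.
move=> h; rewrite /bump; elim/big_ind: _ => [|a b|i _]; first lra.
  exact: Rmult_lt_0_compat.
have hi := h i (leq_ord i).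
by rewrite Rmax_right; lra.
Qed.

Lemma bump_eq0 (d : nat) eps (mu : nat -> (pt d -> Prop) -> R) p i :
  (i <= d)%N -> eps <= mu i (halfspace_of p) -> bump eps mu p = 0.
Proof.
move=> id hi; rewrite /bump (bigD1 (Ordinal (id : (i < d.+1)%N))) //=.
by rewrite Rmax_left ?Rmult_0_l //; lra.
Qed.

Theorem theorem1 (d : nat) (eps : R) (mu : nat -> (pt d -> Prop) -> R) :
  (1 <= d)%N ->
  0 < eps < 1 / 2 ->
  (forall i, (i <= d)%N -> prob_measure (mu i) /\ abs_continuous (mu i)) ->
  not_permuted eps mu ->
  exists (u : pt d) (c : R), nonzero_vec u /\
    (forall i, (i <= d)%N -> mu i (halfspace u c) = mu 0%N (halfspace u c)) /\
    eps <= mu 0%N (halfspace u c) <= 1 / 2.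
Proof.
case: d mu => [//|n] mu _ heps hmu hnp.
(* With [d = n.+1] there are [d] consecutive differences on the nonzero vectors of R^(d+1), as
   Borsuk-Ulam requires. *)
pose G (p : 'I_n.+2 -> R) (j : 'I_n.+1) : R :=
  mu j.+1 (halfspace_of p) - mu j (halfspace_of p)
  - (bump eps mu p - bump eps mu (neg p)).
have fneg i p : (i <= n.+1)%N -> nonzero_vec p ->
    mu i (halfspace_of (neg p)) = 1 - mu i (halfspace_of p).
  by move=> /hmu[pm ac]; exact: measure_halfspace_neg.
have nzneg d (p : pt d) : nonzero_vec p -> nonzero_vec (neg p).
  by move=> [i hi]; exists i; rewrite /neg; lra.
have [p [pnz hG]] : exists p, nonzero_vec p /\ forall j, G p j = 0.
  apply: borsuk_ulam.
    move=> p pnz; apply: funext => j.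
    rewrite /G negK [neg (fun=> _) _]/neg !fneg //; last exact: ltnW.
    lra.
  have fcv (p : nat -> 'I_n.+2 -> R) l i : (i <= n.+1)%N -> nonzero_vec l ->
      (forall i, Un_cv (fun m => p m i) (l i)) ->
      Un_cv (fun m => mu i (halfspace_of (p m))) (mu i (halfspace_of l)).
    by move=> /hmu[pm ac]; exact: measure_halfspace_cv.
  have bcv (p : nat -> 'I_n.+2 -> R) l : nonzero_vec l ->
      (forall i, Un_cv (fun m => p m i) (l i)) ->
      Un_cv (fun m => bump eps mu (p m)) (bump eps mu l).
    move=> lnz pl; apply: Un_cv_prod => i; apply: Un_cv_Rmax0.
    apply: CV_minus; first exact: Un_cv_const.
    by apply: fcv => //; apply: leq_ord.
  move=> p l lnz pl j; apply: CV_minus; apply: CV_minus.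
  - by apply: fcv.
  - by apply: fcv => //; apply: ltnW.
  - exact: bcv.
  - by apply: bcv; [exact: nzneg|move=> i; apply: CV_opp].
have diff (j : 'I_n.+1) : mu j.+1 (halfspace_of p) - mu j (halfspace_of p)
    = bump eps mu p - bump eps mu (neg p).
  by have := hG j; rewrite /G; lra.
(* A zero of G inside the region where the bump is positive would order the
   measures strictly, so the bump vanishes and all measures agree. *)
have no_bump q : nonzero_vec q ->
    (forall j : 'I_n.+1, mu j.+1 (halfspace_of q) - mu j (halfspace_of q)
       = bump eps mu q - bump eps mu (neg q)) ->
    exists2 i, (i <= n.+1)%N & eps <= mu i (halfspace_of q).
  move=> qnz qdiff; apply: contrapT => hno.
  have small i : (i <= n.+1)%N -> mu i (halfspace_of q) < eps.
    move=> id; case: (Rlt_le_dec (mu i (halfspace_of q)) eps) => // h.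
    by case: hno; exists i.
  have b0 := bump_gt0 small.
  (* At [neg q] the measure [mu 0] exceeds [1 - eps], hence [eps], as [eps < 1 / 2]. *)
  have bn : bump eps mu (neg q) = 0.
    apply: (@bump_eq0 _ _ _ _ 0%N) => //; rewrite fneg //.
    by have := small 0%N isT; lra.
  have inc i j : (i < j)%N -> (j <= n.+1)%N ->
      mu i (halfspace_of q) < mu j (halfspace_of q).
    elim: j => // j IHj; rewrite ltnS leq_eqVlt => /predU1P[->|ij] jn.
      by have := qdiff (Ordinal jn); rewrite /= bn; lra.
    apply: Rlt_trans (IHj ij (ltnW jn)) _.
    by have := qdiff (Ordinal jn); rewrite /= bn; lra.
  (* The condition [not_permuted] speaks only of nonzero normals; at a pole all measures agree,
     against strict increase. *)
  case: (pselect (nonzero_vec (normal q))) => un.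
    have [i [j [ij [jd]]]] := hnp _ _ un small.
    by have := inc i j ij jd; rewrite /halfspace_of; lra.
  have := inc 0%N 1%N isT isT.
  by have [h|h] := measure_halfspace_pole un qnz;
    rewrite (h _ (hmu 0%N isT).1) (h _ (hmu 1%N isT).1); lra.
have [i0 i0d hi0] := no_bump p pnz diff.
have bp : bump eps mu p = 0 by apply: bump_eq0 hi0.
(* Both sides of [diff] change sign under [neg], so [no_bump] applies to [neg p] too. *)
have [i1 i1d hi1] : exists2 i, (i <= n.+1)%N & eps <= mu i (halfspace_of (neg p)).
  apply: no_bump => [|j]; first exact: nzneg.
  by rewrite negK !fneg ?(ltnW (ltn_ord j)) ?ltn_ord //; have := diff j; lra.
have bn : bump eps mu (neg p) = 0 by apply: bump_eq0 hi1.
have eqp i : (i <= n.+1)%N -> mu i (halfspace_of p) = mu 0%N (halfspace_of p).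
  elim: i => // i IHi id; rewrite -(IHi (ltnW id)).
  by have := diff (Ordinal id); rewrite /= bp bn; lra.
(* At a pole all measures vanish at [p] or at [neg p], against the lower bound [eps] at both. *)
have un : nonzero_vec (normal p).
  apply: contrapT => un; move: hi0 hi1; rewrite fneg //.
  by have [h|h] := measure_halfspace_pole un pnz;
    [rewrite (h _ (hmu i0 i0d).1)|rewrite (h _ (hmu i1 i1d).1)]; lra.
rewrite eqp // in hi0; rewrite fneg // eqp // in hi1.
(* The common values at [p] and [neg p] add up to 1 and are both at least [eps]; the smaller one is
   taken. *)
case: (Rle_lt_dec (mu 0%N (halfspace_of p)) (1 / 2)) => half.
  by exists (normal p), (p ord0); split.
exists (normal (neg p)), (neg p ord0); split; first exact: nzneg un.
rewrite -/(halfspace_of (neg p)); split=> [i id|]; rewrite !fneg ?eqp //; lra.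
Qed.
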